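(* Let $K$ be a tame, prime and alternating knot with a regular and common (alternating) projection. Then the Dehn presentation of the knot group $\pi_1(\mathbb{R}^3\setminus K)$ of $K$ has a complete and finite rewriting system.
   Context: Projection. $\wp(K)\subset\mathbb{R}^2$ denotes the projection of $K$; it is regular (finitely many multiple points, all of them transverse double points, called crossings, with over/under information; so it is a 4-valent plane graph) and alternating (over- and under-crossings alternate along $K$). The domains are the connected components of $\mathbb{R}^2\setminus\wp(K)$. The projection is common if the boundaries of any two distinct domains have at most one edge in common and each crossing is on the boundary of exactly four distinct domains. Prime knots are nontrivial, so there is at least one crossing. Dehn presentation. Label the domains $x_0,x_1,\dots,x_n$, with $x_0$ the unbounded one; there are $n-1$ crossings. Write $\overline{x}$ for the inverse of $x$. At each crossing four distinct domains $x_a,x_b,x_c,x_d$ meet, in this cyclic order around the crossing, labelled so that the overcrossing strand separates $x_a$ from $x_b$ (and $x_c$ from $x_d$); the relator of the crossing is $x_a\overline{x_b}x_c\overline{x_d}$. With $r_1,\dots,r_{n-1}$ the relators of the crossings, the Dehn presentation is $\langle x_0,x_1,\dots,x_n\mid r_1,\dots,r_{n-1},x_0\rangle$; it presents $G=\pi_1(\mathbb{R}^3\setminus K)$. Equivalently, deleting $x_0$ everywhere, $G=\langle x_1,\dots,x_n\mid \Phi(r_1),\dots,\Phi(r_{n-1})\rangle$, where $\Phi$ sends $x_0$ to $1$ and fixes $x_1,\dots,x_n$. Rewriting systems. A rewriting system on a set $\Sigma$ is a set $\Re\subset\Sigma^*\times\Sigma^*$ of rules $l\to r$; write $ulv\to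 urv$ for $(l,r)\in\Re$, $u,v\in\Sigma^*$. Let $\to^*$ be the reflexive transitive closure of $\to$ and $\leftrightarrow^*$ the equivalence relation generated by $\to$. $\Re$ is terminating if there is no infinite sequence $w_1\to w_2\to\cdots$; it is locally confluent if $w\to u$ and $w\to v$ imply that there is $z$ with $u\to^*z$ and $v\to^*z$; it is complete if it is terminating and locally confluent. A rewriting system for the Dehn presentation of $G$ is a rewriting system on $\Sigma=\{x_1,\dots,x_n,\overline{x_1},\dots,\overline{x_n}\}$ such that two words of $\Sigma^*$ are $\leftrightarrow^*$-equivalent if and only if they represent the same element of $G$. It is finite if it has finitely many rules. *)

(* Defs.v *)
From mathcomp Require Import all_boot all_order all_algebra.
From mathcomp Require Import all_classical all_reals all_analysis.
From Stdlib Require Import Relation_Operators.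

Set Implicit Arguments.
Unset Strict Implicit.
Unset Printing Implicit Defensive.

Import Order.TTheory GRing.Theory Num.Theory.
Import numFieldNormedType.Exports.

Local Open Scope classical_set_scope.
Local Open Scope card_scope.
Local Open Scope ring_scope.

(** * String rewriting *)

Section Rewriting.
Variable T : Type.
Implicit Types (RR : set (seq T * seq T)) (u v w : seq T).

Definition rewrites RR w w' : Prop :=
  exists u v l r, [/\ RR (l, r), w = u ++ l ++ v & w' = u ++ r ++ v].

Definition rewrites_star RR : seq T -> seq T -> Prop :=
  clos_refl_trans (seq T) (rewrites RR).

Definition rewrites_equiv RR : seq T -> seq T -> Prop :=
  clos_refl_sym_trans (seq T) (rewrites RR).

Definition terminating RR : Prop :=
  ~ exists w : nat -> seq T, forall i, rewrites RR (w i) (w i.+1).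

Definition locally_confluent RR : Prop :=
  forall w u v, rewrites RR w u -> rewrites RR w v ->
  exists z, rewrites_star RR u z /\ rewrites_star RR v z.

Definition complete_rewriting RR : Prop := terminating RR /\ locally_confluent RR.

End Rewriting.

(** * Group presentations *)

(* The letter (i, true) is the generator x_i, and (i, false) its inverse. *)
Notation letter I := (I * bool)%type.

(* Two words represent the same element of the group < I | rels > iff one can
   be transformed into the other by inserting and deleting relators and
   subwords x x^-1, x^-1 x. *)
Definition presentation_rules (I : Type) (rels : set (seq (letter I))) :
    set (seq (letter I) * seq (letter I)) :=
  [set lr | rels lr.1 /\ lr.2 = [::]] `|`
  [set lr | exists i e, lr = ([:: (i, e); (i, ~~ e)], [::])].

Definition same_element (I : Type) (rels : set (seq (letter I))) :
    seq (letter I) -> seq (letter I) -> Prop :=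
  rewrites_equiv (presentation_rules rels).

Definition dehn_relator (I : Type) (a b c d : I) : seq (letter I) :=
  [:: (a, true); (b, false); (c, true); (d, false)].

(* < x_0, ..., x_n | r_0, ..., r_(m-1), x_0 >, where r_j is the relator
   x_(a j) x_(b j)^-1 x_(c j) x_(d j)^-1 *)
Definition dehn_relators (n m : nat) (a b c d : 'I_m -> 'I_n.+1) :
    set (seq (letter 'I_n.+1)) :=
  [set r | exists j, r = dehn_relator (a j) (b j) (c j) (d j)] `|`
  [set [:: (ord0, true)]].

(* Rewriting systems for the Dehn presentation are over x_1, ..., x_n and their
   inverses only; the index i : 'I_n stands for x_(i+1). *)
Definition word_incl (n : nat) (w : seq (letter 'I_n)) : seq (letter 'I_n.+1) :=
  [seq (lift ord0 l.1, l.2) | l <- w].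

Definition rewriting_system_for_dehn (n m : nat) (a b c d : 'I_m -> 'I_n.+1)
    (RR : set (seq (letter 'I_n) * seq (letter 'I_n))) : Prop :=
  forall u v, rewrites_equiv RR u v <->
    same_element (dehn_relators a b c d) (word_incl u) (word_incl v).

(** * Knots *)

Notation plane R := (R * R)%type.
Notation space R := (R * R * R)%type.

(* A knot, given by a parametrisation with period 1 of a simple closed curve in
   the space. *)
Record knot (R : realType) := Knot {
  knot_fun :> R -> space R;
  knot_continuous : continuous knot_fun;
  knot_period : forall s t,
    knot_fun s = knot_fun t <-> exists k : int, s = t + k%:~R }.

Section KnotTypes.
Variable R : realType.
Implicit Types (A B : set (space R)) (K : knot R).

Definition ambient_equivalent A B : Prop :=
  exists h g : space R -> space R,
    [/\ continuous h, continuous g, cancel h g, cancel g h & h @` A = B].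

Definition segment (P Q : space R) : set (space R) :=
  [set P + t *: (Q - P) | t in `[0, 1]].

Definition polygonal A : Prop :=
  exists s : seq (space R * space R),
    A = [set P | exists2 e, e \in s & segment e.1 e.2 P].

Definition tame K : Prop :=
  exists K' : knot R, polygonal (range K') /\ ambient_equivalent (range K) (range K').

Definition unit_circle : set (space R) :=
  [set P | P.1.1 ^+ 2 + P.1.2 ^+ 2 = 1 /\ P.2 = 0].

Definition trivial_knot A : Prop := ambient_equivalent A unit_circle.

(* A polygonal knot A that meets the plane z = 0 in exactly two points P and Q,
   and has points on both sides of it, is the composition of the knots obtained
   by closing its upper and its lower arc with the segment PQ. *)
Definition composition_at A (P Q : space R) : Prop :=
  [/\ P <> Q, A `&` [set S | S.2 = 0] = [set P; Q],
      exists2 S, A S & 0 < S.2 & exists2 S, A S & S.2 < 0].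

Definition upper_factor A (P Q : space R) : set (space R) :=
  (A `&` [set S | 0 <= S.2]) `|` segment P Q.

Definition lower_factor A (P Q : space R) : set (space R) :=
  (A `&` [set S | S.2 <= 0]) `|` segment P Q.

Definition prime_knot K : Prop :=
  ~ trivial_knot (range K) /\
  forall (K' : knot R) (P Q : space R),
    polygonal (range K') -> ambient_equivalent (range K) (range K') ->
    composition_at (range K') P Q ->
    trivial_knot (upper_factor (range K') P Q) \/
    trivial_knot (lower_factor (range K') P Q).

End KnotTypes.

(** * Projections *)

Section Projection.
Variable R : realType.
Implicit Types (K : knot R) (p : plane R) (D : set (plane R)).

(* The projection is along the third axis, the viewer being at z = +oo. *)
Definition projection K : set (plane R) := [set P.1 | P in range K].

Definition multiple_point K p : Prop :=
  exists A B, [/\ range K A, range K B, A <> B, A.1 = p & B.1 = p].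

Definition open_embedding (psi : plane R -> plane R) : Prop :=
  [/\ continuous psi, injective psi & forall U, open U -> open (psi @` U)].

(* p is a transverse double point, with the strand of parameter s over the
   strand of parameter t: in the local coordinates psi around p, the projection
   is the union of the two axes, the horizontal one being the projection of the
   overcrossing strand and the vertical one that of the undercrossing strand. *)
Record crossing_chart K p (s t : R) (psi : plane R -> plane R) : Prop := {
  chart_embedding : open_embedding psi;
  chart_center : psi (0, 0) = p;
  chart_image : psi @^-1` projection K = [set q | q.1 = 0 \/ q.2 = 0];
  chart_over_center : (K s).1 = p;
  chart_under_center : (K t).1 = p;
  chart_height : (K t).2 < (K s).2;
  chart_double : forall u, (K u).1 = p -> K u = K s \/ K u = K t;
  chart_over : \forall u \near s, exists x, (K u).1 = psi (x, 0);
  chart_under : \forall u \near t, exists y, (K u).1 = psi (0, y) }.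

(* In a neighbourhood of p the projection is a single arc, with two sides.  For
   simple points this is no restriction, by the Schoenflies theorem; it makes
   the projection a plane graph whatever the regularity of the knot. *)
Definition simple_arc_at K p : Prop :=
  exists psi, [/\ open_embedding psi, psi (0, 0) = p &
    psi @^-1` projection K = [set q | q.2 = 0]].

Definition regular_projection K : Prop :=
  [/\ finite_set (multiple_point K),
      forall p, multiple_point K p -> exists s t psi, crossing_chart K p s t psi &
      forall p, projection K p -> ~ multiple_point K p -> simple_arc_at K p].

Definition over_at K (s : R) : Prop :=
  exists2 A, range K A & A.1 = (K s).1 /\ A.2 < (K s).2.

Definition under_at K (s : R) : Prop :=
  exists2 A, range K A & A.1 = (K s).1 /\ (K s).2 < A.2.

Definition alternating_projection K : Prop :=
  forall s t : R, s < t ->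
    multiple_point K (K s).1 -> multiple_point K (K t).1 ->
    (forall u, s < u -> u < t -> ~ multiple_point K (K u).1) ->
    (over_at K s <-> under_at K t).

Definition components (A : set (plane R)) : set (set (plane R)) :=
  [set connected_component A p | p in A].

Definition domain K : set (set (plane R)) := components (~` projection K).

(* The (open) edges of the plane graph whose vertices are the crossings *)
Definition edge K : set (set (plane R)) :=
  components (projection K `\` multiple_point K).

Definition boundary D : set (plane R) := closure D `\` D°.

Definition common_projection K : Prop :=
  (forall D1 D2, domain K D1 -> domain K D2 -> D1 <> D2 ->
     forall e1 e2, edge K e1 -> edge K e2 ->
       e1 `<=` boundary D1 `&` boundary D2 ->
       e2 `<=` boundary D1 `&` boundary D2 -> e1 = e2) /\
  (forall p, multiple_point K p ->
     [set D | domain K D /\ boundary D p] #= `I_4).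

(* a, b, c, d are met in this cyclic order around the crossing p, the half-axes
   of the overcrossing strand lying between a and b and between c and d. *)
Definition domains_around K p (a b c d : set (plane R)) : Prop :=
  exists s t psi, [/\ crossing_chart K p s t psi,
    psi @` [set q | 0 < q.1 /\ 0 < q.2] `<=` a,
    psi @` [set q | 0 < q.1 /\ q.2 < 0] `<=` b,
    psi @` [set q | q.1 < 0 /\ q.2 < 0] `<=` c &
    psi @` [set q | q.1 < 0 /\ 0 < q.2] `<=` d].

Definition domain_labelling K (n : nat) (x : 'I_n.+1 -> set (plane R)) : Prop :=
  set_bij setT (domain K) x /\ ~ bounded_set (x ord0).

(* The crossings are enumerated by 'I_m (in fact m = n - 1), and the four
   domains at each of them are labelled as in the definition of its relator.
   There are four such labellings at each crossing; the relators that they give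
   are cyclic permutations of each other or of each other's inverse. *)
Definition dehn_data K (n m : nat) (x : 'I_n.+1 -> set (plane R))
    (a b c d : 'I_m -> 'I_n.+1) : Prop :=
  domain_labelling K x /\
  exists2 p : 'I_m -> plane R, set_bij setT (multiple_point K) p &
    forall j, domains_around K (p j) (x (a j)) (x (b j)) (x (c j)) (x (d j)).

End Projection.

(* Main.v *)
(* The domains have a checkerboard colouring, in which x_0 may be taken white.  A
   crossing with black domains a, c and white domains b, d then gives the
   relations a b^-1 = d c^-1 and a^-1 d = b^-1 c.  As the projection is alternating
   and common, two adjacent domains are separated by an overcrossing strand at
   exactly one crossing and by an undercrossing strand at exactly one crossing.  So
   the rules that move a black letter to the right past a white one of the
   opposite sign are deterministic and overlap only with free cancellations: before
   x_0 is deleted they form a complete system.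

   The crossings of the unbounded domain become relations a a' = e, where a and a'
   are consecutive neighbours of the unbounded domain and e is opposite to it.  The
   generators a are eliminated by the (length-increasing) rules a -> e a'^-1, and
   completion adds only a'^-1 a^-1 -> e^-1 and a'^-1 b^-1 -> e^-1 d c^-1, the
   latter for each crossing with a b^-1 = d c^-1.

   The colouring needs no Jordan curve theorem: colourings exist locally, by the
   charts of the projection, two colourings of a connected open set differ by a
   constant, and so local colourings can be glued along rectangles.  The edges are
   the images of the intervals between consecutive parameters of multiple points:
   these are clopen in the set of simple points, by compactness; alternation says
   that one end of each is an overcrossing and the other an undercrossing. *)

Require Import Defs.
From mathcomp Require Import all_boot all_order all_algebra.
From mathcomp Require Import all_classical all_reals all_analysis.
From mathcomp Require Import zify lra.
From Stdlib Require Import Relation_Operators.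

Set Implicit Arguments.
Unset Strict Implicit.
Unset Printing Implicit Defensive.

Import Order.TTheory GRing.Theory Num.Theory.
Import numFieldNormedType.Exports.

Local Open Scope classical_set_scope.

(** * String rewriting *)

Section RewritingTheory.
Variables (T : Type) (RR : set (seq T * seq T)).
Implicit Types u v w : seq T.

Lemma rewrites_cat u v w w' :
  rewrites RR w w' -> rewrites RR (u ++ w ++ v) (u ++ w' ++ v).
Proof.
case=> u1 [v1 [l [r [lr -> ->]]]]; exists (u ++ u1), (v1 ++ v), l, r.
by split=> //; rewrite !catA.
Qed.

Lemma rewrites_star_cat u v w w' :
  rewrites_star RR w w' -> rewrites_star RR (u ++ w ++ v) (u ++ w' ++ v).
Proof.
elim=> [x y xy|x|x y z _ xy _ yz]; first exact/rt_step/rewrites_cat.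
  exact: rt_refl.
exact: rt_trans xy yz.
Qed.

Lemma rewrites_equiv_cat u v w w' :
  rewrites_equiv RR w w' -> rewrites_equiv RR (u ++ w ++ v) (u ++ w' ++ v).
Proof.
elim=> [x y xy|x|x y _ xy|x y z _ xy _ yz]; first exact/rst_step/rewrites_cat.
- exact: rst_refl.
- exact: rst_sym.
- exact: rst_trans xy yz.
Qed.

Lemma rewrites_star_equiv w w' : rewrites_star RR w w' -> rewrites_equiv RR w w'.
Proof.
elim=> [x y xy|x|x y z _ xy _ yz]; first exact: rst_step.
  exact: rst_refl.
exact: rst_trans xy yz.
Qed.

Lemma rewrites_rule l r : RR (l, r) -> rewrites RR l r.
Proof. by move=> lr; exists [::], [::], l, r; rewrite !cats0. Qed.

End RewritingTheory.

(** * The rewriting system of a checkerboard coloured diagram *)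

Section DehnRewriting.
Variables (n : nat) (col : 'I_n.+1 -> bool).
(* Sq a b c d: the domains around a crossing, with a and c black and the
   overcrossing strand between a and b and between c and d. *)
Variable Sq : 'I_n.+1 -> 'I_n.+1 -> 'I_n.+1 -> 'I_n.+1 -> Prop.
Hypothesis col0 : col ord0 = false.
Hypothesis Sq_rot : forall a b c d, Sq a b c d -> Sq c d a b.
Hypothesis Sq_col : forall a b c d, Sq a b c d ->
  [/\ col a, ~~ col b, col c & ~~ col d].
Hypothesis Sq_neq : forall a b c d, Sq a b c d -> b <> d.
Hypothesis Sq_over : forall a b c d c' d', Sq a b c d -> Sq a b c' d' ->
  c = c' /\ d = d'.
Hypothesis Sq_under : forall a b c d b' c', Sq a b c d -> Sq a b' c' d ->
  b = b' /\ c = c'.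
Hypothesis Sq_edge0 : forall a,
  (exists c d, Sq a ord0 c d) <-> (exists b c, Sq a b c ord0).

Local Notation dom := 'I_n.+1.
Local Notation word := (seq (letter dom)).

(* For an outer domain a, the crossing at which the overcrossing strand separates
   it from x_0 gives the relation a * nx a = opp a; junk value x_0 otherwise. *)
Definition next (a : dom) : dom * dom := xget (ord0, ord0) [set p | Sq a ord0 p.1 p.2].
Definition nx a := (next a).1.
Definition opp a := (next a).2.
Definition outer a := exists c d, Sq a ord0 c d.

Lemma outerP a : outer a -> Sq a ord0 (nx a) (opp a).
Proof.
case=> c [d Sqa].
by have := xgetPex (ord0, ord0) (ex_intro [set p | Sq a ord0 p.1 p.2] (c, d) Sqa).
Qed.

(** Turned by half a turn, the crossing of [a] with x_0 has an undercrossing strand between [nx a]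
    and x_0; [Sq_edge0] then supplies an overcrossing one. *)
Lemma outer_nx a : outer a -> outer (nx a).
Proof. by move=> /outerP/Sq_rot Sqa; apply/Sq_edge0; exists (opp a), a. Qed.

Lemma Sq_outer a c d : Sq a ord0 c d -> [/\ outer a, nx a = c & opp a = d].
Proof.
move=> Sqa; have oa : outer a by exists c, d.
by case: (Sq_over (outerP oa) Sqa).
Qed.

Lemma nx_inj a a' : outer a -> outer a' -> nx a = nx a' -> a = a'.
Proof.
move=> /outerP/Sq_rot Sqa /outerP/Sq_rot Sqa' eq_nx; rewrite -eq_nx in Sqa'.
by case: (Sq_under Sqa Sqa').
Qed.

Lemma col_outer a : outer a -> col a.
Proof. by move=> /outerP/Sq_col[]. Qed.

Lemma col_opp a : outer a -> ~~ col (opp a).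
Proof. by move=> /outerP/Sq_col[]. Qed.

Lemma opp_neq0 a : outer a -> opp a <> ord0.
Proof. by move=> /outerP/Sq_neq/nesym. Qed.

Definition expand a : word :=
  if `[< outer a >] then [:: (opp a, true); (nx a, false)] else [:: (a, true)].

Lemma expandT a : outer a -> expand a = [:: (opp a, true); (nx a, false)].
Proof. by rewrite /expand; case: asboolP. Qed.

Lemma expandF a : ~ outer a -> expand a = [:: (a, true)].
Proof. by rewrite /expand; case: asboolP. Qed.

(** In any [Sq a b c d] the relation is a b^-1 = d c^-1, equivalently a^-1 d = b^-1 c. A positive
    outer letter is always rewritten by [Rule1], which is why [SwapNP] expands the black letter it
    creates. [SwapNN] is the substitute for [SwapPN] at an outer [a]: replace [a] by (opp a) (nx
    a)^-1 and move [opp a] to the right-hand side. *)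
Inductive rule2 : letter dom -> letter dom -> word -> Prop :=
| SwapPN a b c d of ~ outer a & Sq a b c d :
    rule2 (a, true) (b, false) [:: (d, true); (c, false)]
| SwapNP a b c d of d <> ord0 & Sq a b c d :
    rule2 (a, false) (d, true) ((b, false) :: expand c)
| Merge a of outer a :
    rule2 (nx a, false) (a, false) [:: (opp a, false)]
| SwapNN a b c d of outer a & b <> ord0 & Sq a b c d :
    rule2 (nx a, false) (b, false) [:: (opp a, false); (d, true); (c, false)]
| Cancel x e of x <> ord0 & ~ outer x : rule2 (x, e) (x, ~~ e) [::].

Inductive rule : word -> word -> Prop :=
| Rule1 a of outer a : rule [:: (a, true)] [:: (opp a, true); (nx a, false)]
| Rule2 x y r of rule2 x y r : rule [:: x; y] r.

Definition erase (w : word) : seq (letter 'I_n) :=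
  pmap (fun l => omap (fun i => (i, l.2)) (unlift ord0 l.1)) w.

Lemma erase_cat u v : erase (u ++ v) = erase u ++ erase v.
Proof. exact: pmap_cat. Qed.

Lemma erase_incl w : erase (word_incl w) = w.
Proof. by elim: w => [//|[i e] w IHw]; rewrite /erase /= liftK /= [X in _ :: X]IHw. Qed.

Lemma erase_ord0 e w : erase ((ord0, e) :: w) = erase w.
Proof. by rewrite /erase /= unlift_none. Qed.

Lemma incl_erase_cons x e w : x <> ord0 ->
  word_incl (erase ((x, e) :: w)) = (x, e) :: word_incl (erase w).
Proof.
by move=> /eqP; rewrite eq_sym => /unlift_some[i -> hi]; rewrite /erase /= hi.
Qed.

Definition dehn_system : set (seq (letter 'I_n) * seq (letter 'I_n)) :=
  [set p | exists l r, [/\ rule l r, p.1 = erase l & p.2 = erase r]].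

Lemma black_neq0 a : col a -> a <> ord0.
Proof. by move=> + a0; rewrite a0 col0. Qed.

(** Black letters differ from the white x_0, and b = x_0 in [SwapPN] would make [a] outer. Hence
    erasing x_0 affects right-hand sides only. *)
Lemma rule2_neq0 x y r : rule2 x y r -> x.1 <> ord0 /\ y.1 <> ord0.
Proof.
case=> [a b c d oa sq|a b c d d0 sq|a oa|a b c d oa b0 sq|//] /=.
- have [ca _ _ _] := Sq_col sq; split; first exact: black_neq0.
  by move=> b0; rewrite b0 in sq; case: (Sq_outer sq).
- by have [ca _ _ _] := Sq_col sq; split=> //; exact: black_neq0.
- by split; apply: black_neq0; apply: col_outer => //; exact: outer_nx.
- by split=> //; apply/black_neq0/col_outer/outer_nx.
Qed.

Lemma incl_erase_lhs l r : rule l r -> word_incl (erase l) = l.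
Proof.
case=> [a /col_outer/black_neq0 a0|[x e] [y e'] {}r /rule2_neq0[x0 y0]].
  by rewrite incl_erase_cons.
by rewrite !incl_erase_cons.
Qed.

(** ** Reduction of words over all domains, up to the letters of the unbounded one *)

(** Keeping the letters of x_0 until the end lets one crossing relation cover both bounded and
    unbounded domains. *)
Definition red (u v : word) := rewrites_star dehn_system (erase u) (erase v).

Lemma red_refl u : red u u. Proof. exact: rt_refl. Qed.

Lemma red_trans v u w : red u v -> red v w -> red u w.
Proof. exact: rt_trans. Qed.

Lemma red_cat u v w w' : red w w' -> red (u ++ w ++ v) (u ++ w' ++ v).
Proof. by move=> ww'; rewrite /red !erase_cat; exact: rewrites_star_cat. Qed.

Lemma red_at u v l r w z :
  red l r -> w = u ++ l ++ v -> red (u ++ r ++ v) z -> red w z.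
Proof. by move=> lr ->; apply/red_trans/red_cat. Qed.

Lemma red_rule l r : rule l r -> red l r.
Proof. by move=> lr; apply/rt_step/rewrites_rule; exists l, r. Qed.

Lemma red_rule2 x y r : rule2 x y r -> red [:: x; y] r.
Proof. by move=> /Rule2/red_rule. Qed.

Lemma red_ord0 e : red [:: (ord0, e)] [::].
Proof. by rewrite /red erase_ord0; exact: rt_refl. Qed.

Lemma red_expand a : red [:: (a, true)] (expand a).
Proof.
have [oa|oa] := pselect (outer a); last by rewrite expandF //; exact: red_refl.
by rewrite expandT //; exact/red_rule/Rule1.
Qed.

Lemma white_outer x : ~~ col x -> ~ outer x.
Proof. by move=> cx /col_outer; rewrite (negbTE cx). Qed.

Lemma red_white x e : ~~ col x -> red [:: (x, e); (x, ~~ e)] [::].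
Proof.
move=> cx; have [->|x0] := eqVneq x ord0.
  by rewrite /red !erase_ord0; exact: rt_refl.
by apply/red_rule2/Cancel; [exact/eqP|exact: white_outer].
Qed.

Lemma red_merge a : outer a -> red [:: (nx a, false); (a, false)] [:: (opp a, false)].
Proof. by move=> oa; exact/red_rule2/Merge. Qed.

Lemma red_swapNP a b c d : Sq a b c d -> d <> ord0 ->
  red [:: (a, false); (d, true)] ((b, false) :: expand c).
Proof. by move=> sq d0; exact/red_rule2/SwapNP. Qed.

Lemma red_expandN a : red (expand a ++ [:: (a, false)]) [::].
Proof.
have [oa|oa] := pselect (outer a).
  rewrite expandT //; apply: (red_at (u := [:: (opp a, true)]) (v := [::]) (red_merge oa) erefl).
  exact/red_white/col_opp.
rewrite expandF //; have [->|/eqP a0] := eqVneq a ord0; first exact/red_white/negbT.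
exact/red_rule2/(@Cancel a true).
Qed.

(** For outer [a], [SwapNP] applies at the crossing of [a] with x_0: the white letter it creates is
    x_0 and disappears, leaving [expand (nx a)] before the inverse of [nx a]. *)
Lemma red_Nexpand a : red ((a, false) :: expand a) [::].
Proof.
have [oa|oa] := pselect (outer a).
  rewrite expandT //.
  apply: (red_at (u := [::]) (v := [:: (nx a, false)]) (red_swapNP (outerP oa) (opp_neq0 oa)) erefl).
  rewrite /= /red erase_ord0; exact: red_expandN.
rewrite expandF //; have [->|/eqP a0] := eqVneq a ord0; first exact/red_white/negbT.
exact/red_rule2/(@Cancel a false).
Qed.

(** [Cancel] excludes outer letters; for them the cancellation is derived by expanding the positive
    one. *)
Lemma red_cancel x e : red [:: (x, e); (x, ~~ e)] [::].
Proof.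
case: e => /=.
  apply: (red_at (u := [::]) (v := [:: (x, false)]) (red_expand x) erefl).
  exact: red_expandN.
apply: (red_at (u := [:: (x, false)]) (v := [::]) (red_expand x) erefl).
rewrite cats0; exact: red_Nexpand.
Qed.

(** For outer [a], the crossing with b = x_0 is the expansion itself; at any other crossing [SwapNN]
    applies, and [opp a] cancels. *)
Lemma red_expand_swap a b c d : Sq a b c d ->
  red (expand a ++ [:: (b, false)]) [:: (d, true); (c, false)].
Proof.
move=> sq; have [oa|oa] := pselect (outer a); last first.
  by rewrite expandF //; apply/red_rule2/SwapPN.
rewrite expandT //; have [b0|/eqP b0] := eqVneq b ord0.
  rewrite b0 in sq; have [_ -> ->] := Sq_outer sq.
  rewrite b0; apply: (red_at (u := [:: (d, true); (c, false)]) (v := [::]) (red_ord0 _) erefl).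
  exact: red_refl.
apply: (red_at (u := [:: (opp a, true)]) (v := [::]) (red_rule2 (SwapNN oa b0 sq)) erefl).
apply: (red_at (u := [::]) (v := [:: (d, true); (c, false)]) (red_white true (col_opp oa)) erefl).
exact: red_refl.
Qed.

(** * Critical pairs and local confluence *)

Definition joinable u v := exists z, red u z /\ red v z.

Lemma Sq_black a b c d : Sq a b c d -> ~ outer b /\ ~ outer d.
Proof. by case/Sq_col=> _ /white_outer cb _ /white_outer cd. Qed.

Lemma Sq_white_nx a b c d a' : Sq a b c d -> outer a' -> b <> nx a'.
Proof. by move=> /Sq_black[ob _] /outer_nx oa' eb; rewrite eb in ob. Qed.

Lemma Sq_white a b c d a' b' c' d' : Sq a b c d -> Sq a' b' c' d' -> b <> a' /\ d <> a'.
Proof.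
move=> /Sq_col[_ cb _ cd] /Sq_col[ca' _ _ _].
by split=> e; [rewrite e ca' in cb|rewrite e ca' in cd].
Qed.

Lemma overlap_swap_cancel a b c d : b <> ord0 -> ~ outer a -> Sq a b c d ->
  joinable [:: (d, true); (c, false); (b, true)] [:: (a, true)].
Proof.
move=> b0 oa sq; exists [:: (a, true)]; split; last exact: red_refl.
apply: (red_at (u := [:: (d, true)]) (v := [::]) (red_swapNP (Sq_rot sq) b0) erefl).
rewrite expandF //; exact: (red_at (u := [::]) (v := [:: (a, true)]) (red_cancel d true) erefl (red_refl _)).
Qed.

Lemma red_swap_back a b c d : Sq a b c d ->
  red ((b, false) :: expand c ++ [:: (d, false)]) [:: (a, false)].
Proof.
move=> sq.
apply: (red_at (u := [:: (b, false)]) (v := [::]) (red_expand_swap (Sq_rot sq))); first by rewrite cats0.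
exact: (red_at (u := [::]) (v := [:: (a, false)]) (red_cancel b false) erefl (red_refl _)).
Qed.

Lemma red_expand_cancel u c : red (u ++ expand c ++ [:: (c, false)]) u.
Proof. by apply: (red_at (u := u) (v := [::]) (red_expandN c)); rewrite ?cats0 //; exact: red_refl. Qed.

Lemma red_cancel_expand u c : red (u ++ (c, false) :: expand c) u.
Proof. by apply: (red_at (u := u) (v := [::]) (red_Nexpand c)); rewrite ?cats0 //; exact: red_refl. Qed.

Lemma red_swapNN a b c d : outer a -> b <> ord0 -> Sq a b c d ->
  red [:: (nx a, false); (b, false)] [:: (opp a, false); (d, true); (c, false)].
Proof. by move=> oa b0 sq; exact/red_rule2/SwapNN. Qed.

Lemma overlap_merge_swapNP a b c d : outer a -> Sq a b c d ->
  joinable [:: (opp a, false); (d, true)] ((nx a, false) :: (b, false) :: expand c).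
Proof.
move=> oa sq; have [b0|/eqP b0] := eqVneq b ord0.
  rewrite b0 in sq *; have [_ <- <-] := Sq_outer sq.
  exists [::]; split; first exact: (red_cancel _ false).
  apply: (red_at (u := [:: (nx a, false)]) (v := expand (nx a)) (red_ord0 false) erefl).
  exact: red_Nexpand.
exists [:: (opp a, false); (d, true)]; split; first exact: red_refl.
apply: (red_at (u := [::]) (v := expand c) (red_swapNN oa b0 sq) erefl).
exact: (red_cancel_expand [:: (opp a, false); (d, true)]).
Qed.

(** This resolves the overlap of two [Merge] rules: [SwapNN] is applied at the crossing of [a] with
    x_0 turned by half a turn, so that its positive letter is x_0. *)
Lemma red_nx_opp a : outer a ->
  red [:: (nx (nx a), false); (opp a, false)] [:: (opp (nx a), false); (a, false)].
Proof.
move=> oa; have sq := Sq_rot (outerP oa).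
apply: (red_at (u := [::]) (v := [::]) (red_swapNN (outer_nx oa) (opp_neq0 oa) sq) erefl).
exact: (red_at (u := [:: (opp (nx a), false)]) (v := [:: (a, false)]) (red_ord0 true) erefl (red_refl _)).
Qed.

Lemma overlap_merge_swapNN a b c d : outer a -> b <> ord0 -> Sq a b c d ->
  red [:: (nx (nx a), false); (opp a, false); (d, true); (c, false)]
    [:: (opp (nx a), false); (b, false)].
Proof.
move=> oa b0 sq.
apply: (red_at (u := [::]) (v := [:: (d, true); (c, false)]) (red_nx_opp oa) erefl) => /=.
(* If d = x_0, then [c] is outer with [nx c = a] and [opp c = b], and [Merge] takes the place of
   [SwapNP]. *)
have [d0|/eqP d0] := eqVneq d ord0.
  rewrite d0 in sq *; have [oc <- <-] := Sq_outer (Sq_rot sq).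
  apply: (red_at (u := [:: (opp (nx (nx c)), false); (nx c, false)]) (v := [:: (c, false)]) (red_ord0 true) erefl) => /=.
  apply: (red_at (u := [:: (opp (nx (nx c)), false)]) (v := [::]) (red_merge oc) erefl).
  exact: red_refl.
apply: (red_at (u := [:: (opp (nx a), false)]) (v := [:: (c, false)]) (red_swapNP sq d0) erefl).
exact: (red_expand_cancel [:: (opp (nx a), false); (b, false)]).
Qed.

Lemma overlap_swapNN_cancel a b c d : outer a -> b <> ord0 -> Sq a b c d ->
  red [:: (opp a, false); (d, true); (c, false); (b, true)] [:: (nx a, false)].
Proof.
move=> oa b0 sq.
apply: (red_at (u := [:: (opp a, false); (d, true)]) (v := [::]) (red_swapNP (Sq_rot sq) b0) erefl).
rewrite cats0 /=.
apply: (red_at (u := [:: (opp a, false)]) (v := expand a) (red_cancel d true) erefl) => /=.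
rewrite expandT //.
exact: (red_at (u := [::]) (v := [:: (nx a, false)]) (red_cancel (opp a) false) erefl (red_refl _)).
Qed.

(** A white middle letter [y] can only start a cancellation, since all other rules start with a
    black letter. A black [y] ends only [Merge] or [Cancel], and an outer one never starts a
    [Cancel]. The surviving overlaps are resolved one by one. *)
Lemma overlap_joinable x y z r1 r2 :
  rule2 x y r1 -> rule2 y z r2 -> joinable (r1 ++ [:: z]) (x :: r2).
Proof.
move=> H1 H2; move Ey: y H2 => y' H2; case: H1 Ey.
- move=> a b c d oa sq; case: H2 =>
    [a' b' c' d' oa' sq'|a' b' c' d' d0' sq'|a' oa'|a' b' c' d' oa' b0' sq'|x' e' x0' ox'] //.
  + by case=> /(Sq_white sq sq').1.
  + by case=> /(Sq_white_nx sq oa').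
  + by case=> /(Sq_white_nx sq oa').
  + by case=> ? ?; subst x' e'; exact: overlap_swap_cancel x0' oa sq.
- move=> a b c d d0 sq; case: H2 =>
    [a' b' c' d' oa' sq'|a' b' c' d' d0' sq'|a' oa'|a' b' c' d' oa' b0' sq'|x' e' x0' ox'] //.
  + by case=> /(Sq_white sq sq').2.
  + case=> <- <-; exists [:: (a, false)]; split; last exact: red_refl.
    exact: red_swap_back.
- move=> a oa; case: H2 =>
    [a' b' c' d' oa' sq'|a' b' c' d' d0' sq'|a' oa'|a' b' c' d' oa' b0' sq'|x' e' x0' ox'] //.
  + by case=> ea; rewrite -ea in sq'; exact: overlap_merge_swapNP.
  + case=> ->; exists [:: (opp (nx a'), false); (a', false)].
    by split; [exact: red_refl|exact: red_nx_opp].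
  + case=> ->; exists [:: (opp (nx a'), false); (b', false)].
    by split; [exact: red_refl|exact: overlap_merge_swapNN].
  + by case=> ea; rewrite ea in oa.
- move=> a b c d oa b0 sq; case: H2 =>
    [a' b' c' d' oa' sq'|a' b' c' d' d0' sq'|a' oa'|a' b' c' d' oa' b0' sq'|x' e' x0' ox'] //.
  + by case=> /(Sq_white sq sq').1.
  + by case=> /(Sq_white_nx sq oa').
  + by case=> /(Sq_white_nx sq oa').
  + case=> <- <-; exists [:: (nx a, false)]; split; last exact: red_refl.
    exact: overlap_swapNN_cancel.
- move=> x' e x0 ox; case: H2 =>
    [a b c d oa sq|a b c d d0 sq|a oa|a b c d oa b0 sq|x'' e' x0' ox'] //.
  + case=> ? ee; subst x'; rewrite (_ : e = false); last by case: e ee.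
    exists [:: (b, false)]; split; first exact: red_refl.
    (* If [d] were x_0, [Sq_edge0] would make the cancelled letter outer. *)
    have d0 : d <> ord0 by move=> d0; apply: oa; apply/Sq_edge0; exists b, c; rewrite -d0.
    apply: (red_at (u := [::]) (v := [:: (c, false)]) (red_swapNP sq d0) erefl).
    exact: (red_expand_cancel [:: (b, false)]).
  + case=> ? ee; subst x'; rewrite (_ : e = true); last by case: e ee.
    exists [:: (d, true)]; split; first exact: red_refl.
    have /(@red_at) step := red_rule2 (SwapPN ox sq).
    apply: (step [::] (expand c)); first by [].
    exact: (red_cancel_expand [:: (d, true)]).
  + by case=> ex; rewrite ex in ox; case: ox; exact: outer_nx.
  + by case=> ex; rewrite ex in ox; case: ox; exact: outer_nx.
  + case=> ? ?; subst x'' e'; rewrite negbK.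
    by exists [:: (x', e)]; split; exact: red_refl.
Qed.

Lemma rule2_det x y r r' : rule2 x y r -> rule2 x y r' -> r = r'.
Proof.
move=> H1; move Ex: x => x' H2; move Ey: y H2 => y' H2; case: H1 Ex Ey.
- move=> a b c d oa sq; case: H2 =>
    [a' b' c' d' oa' sq'|a' b' c' d' d0' sq'|a' oa'|a' b' c' d' oa' b0' sq'|x'' e' x0' ox'] //.
  + by case=> ? [?]; subst a' b'; have [-> ->] := Sq_over sq sq'.
  + case=> ? ? [eb _]; subst x'' e'; have [_ + _ _] := Sq_col sq.
    by rewrite eb; have [->] := Sq_col sq.
- move=> a b c d d0 sq; case: H2 =>
    [a' b' c' d' oa' sq'|a' b' c' d' d0' sq'|a' oa'|a' b' c' d' oa' b0' sq'|x'' e' x0' ox'] //.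
  + by case=> ? [?]; subst a' d'; have [-> ->] := Sq_under sq sq'.
  + case=> ? ? [ed _]; subst x'' e'; have [_ _ _] := Sq_col sq.
    by rewrite ed; have [->] := Sq_col sq.
- move=> a oa; case: H2 =>
    [a' b' c' d' oa' sq'|a' b' c' d' d0' sq'|a' oa'|a' b' c' d' oa' b0' sq'|x'' e' x0' ox'] //.
  + by case=> _ [->].
  + by move=> _ [ea]; have [] := Sq_black sq'; rewrite -ea.
  + by move=> [_ <-].
- move=> a b c d oa b0 sq; case: H2 =>
    [a' b' c' d' oa' sq'|a' b' c' d' d0' sq'|a' oa'|a' b' c' d' oa' b0' sq'|x'' e' x0' ox'] //.
  + by move=> _ [ea]; have [] := Sq_black sq; rewrite ea.
  + case=> /(nx_inj oa oa') ? [?]; subst a' b'.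
    by have [-> ->] := Sq_over sq sq'.
  + by move=> [_ <-].
- move=> x'' e x0 ox; case: H2 =>
    [a b c d oa sq|a b c d d0 sq|a oa|a b c d oa b0 sq|x''' e' x0' ox'] //.
  + case=> ? ? [eb _]; subst x'' e; have [+ + _ _] := Sq_col sq.
    by rewrite eb => ->.
  + case=> ? ? [eb _]; subst x'' e; have [+ _ _] := Sq_col sq.
    by rewrite eb => ->.
  + by case=> _ -> [].
  + by case=> _ -> [].
Qed.

(** Consequently [Rule1] overlaps no two-letter rule. *)
Lemma rule2_outer x y r a : rule2 x y r -> outer a -> x <> (a, true) /\ y <> (a, true).
Proof.
move=> H oa; case: H.
- by move=> a' b c d oa' sq; split=> // -[ea]; rewrite ea in oa'.
- by move=> a' b c d d0 sq; split=> // -[ed]; have [_] := Sq_black sq; rewrite ed.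
- by [].
- by [].
- by move=> x' e x0 ox; split=> -[ex _]; rewrite ex in ox.
Qed.

Lemma joinable_cat u v w w' : joinable w w' -> joinable (u ++ w ++ v) (u ++ w' ++ v).
Proof. by case=> z [wz wz']; exists (u ++ z ++ v); split; exact: red_cat. Qed.

Lemma joinable_refl u : joinable u u.
Proof. by exists u; split; exact: red_refl. Qed.

Lemma joinable_sym u v : joinable u v -> joinable v u.
Proof. by case=> z []; exists z. Qed.

Lemma disjoint_joinable l1 r1 l2 r2 t v : rule l1 r1 -> rule l2 r2 ->
  joinable (r1 ++ t ++ l2 ++ v) (l1 ++ t ++ r2 ++ v).
Proof.
move=> /red_rule lr1 /red_rule lr2; exists (r1 ++ t ++ r2 ++ v); split.
  by apply: (red_at (u := r1 ++ t) (v := v) lr2); rewrite -!catA //; exact: red_refl.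
by apply: (red_at (u := [::]) (v := t ++ r2 ++ v) lr1) => //; exact: red_refl.
Qed.

(** Left-hand sides have one or two letters: at offset 0 the rules agree by determinism, at offset 1
    two two-letter rules may share a letter, and otherwise the redexes are disjoint. *)
Lemma prefix_joinable l1 r1 l2 r2 t v1 v2 : rule l1 r1 -> rule l2 r2 ->
  l1 ++ v1 = t ++ l2 ++ v2 -> joinable (r1 ++ v1) (t ++ r2 ++ v2).
Proof.
move=> lr1 lr2; case: lr1 (lr1) => [a oa|x y r H] lr1.
  case: t => [|t1 t] /=; last by case=> <- ->; exact: (disjoint_joinable t v2 lr1 lr2).
  case: lr2 => [a' oa'|x' y' r' H'] /= [].
    by move=> <- <-; exact: joinable_refl.
  by move=> ex _; case: (rule2_outer H' oa); rewrite ex.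
case: t => [|t1 [|t2 t]] /=.
- case: lr2 => [a' oa'|x' y' r' H'] /= [].
    by move=> ex _; case: (rule2_outer H oa'); rewrite ex.
  by move=> ? ? ->; subst x' y'; rewrite (rule2_det H H'); exact: joinable_refl.
- case: lr2 => [a' oa'|x' y' r' H'] /= [].
    by move=> _ ey _; case: (rule2_outer H oa'); rewrite ey.
  move=> <- ? ->; subst x'.
  rewrite (_ : r ++ _ = [::] ++ (r ++ [:: y']) ++ v2); last by rewrite -catA.
  rewrite (_ : x :: r' ++ v2 = [::] ++ (x :: r') ++ v2) //.
  exact/joinable_cat/(overlap_joinable H H').
- by case=> <- <- ->; exact: (disjoint_joinable t v2 lr1 lr2).
Qed.

Lemma suffix_joinable l1 r1 l2 r2 u1 u2 v1 v2 : rule l1 r1 -> rule l2 r2 ->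
  size u1 <= size u2 -> u1 ++ l1 ++ v1 = u2 ++ l2 ++ v2 ->
  joinable (u1 ++ r1 ++ v1) (u2 ++ r2 ++ v2).
Proof.
move=> lr1 lr2 le12 e; rewrite -(cat_take_drop (size u1) u2) in e *.
move: e; rewrite -!catA => /eqP; rewrite eqseq_cat ?size_takel // => /andP[/eqP <- /eqP e].
move: (joinable_cat u1 [::] (prefix_joinable lr1 lr2 e)).
by rewrite !cats0.
Qed.

Lemma incl_cat u v : word_incl (u ++ v) = word_incl u ++ word_incl v :> word.
Proof. exact: map_cat. Qed.

Lemma dehn_system_rewritesP w u : rewrites dehn_system w u ->
  exists u1 l r v1, [/\ rule l r, word_incl w = u1 ++ l ++ v1 & u = erase (u1 ++ r ++ v1)].
Proof.
case=> u1 [v1 [l' [r' [[l [r [lr /= -> ->]]] -> ->]]]].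
exists (word_incl u1), l, r, (word_incl v1); split=> //.
  by rewrite !incl_cat (incl_erase_lhs lr).
by rewrite !erase_cat !erase_incl.
Qed.

Lemma dehn_system_confluent : locally_confluent dehn_system.
Proof.
move=> w u v /dehn_system_rewritesP[u1 [l1 [r1 [v1 [lr1 e1 ->]]]]].
move=> /dehn_system_rewritesP[u2 [l2 [r2 [v2 [lr2 e2 ->]]]]].
suff [z [uz vz]] : joinable (u1 ++ r1 ++ v1) (u2 ++ r2 ++ v2) by exists (erase z).
rewrite e1 in e2; have [le12|/ltnW le21] := leqP (size u1) (size u2).
  exact: (suffix_joinable lr1 lr2 le12).
exact/joinable_sym/(suffix_joinable lr2 lr1 le21).
Qed.

(** ** Termination *)

(* Moving a black letter to the right past a white one may double the white
   letter, and each outer generator x_a may be expanded once: words are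
   interpreted as compositions of affine maps of slope 1 (white) and 3 (black). *)
Definition weight (l : letter dom) (k : nat) : nat :=
  if l.1 == ord0 then k
  else if ~~ col l.1 then k.+1
  else if l.2 && `[< outer l.1 >] then 3 * k + 3 else 3 * k + 1.

Definition weigh (w : word) (k : nat) : nat := foldr weight k w.

Lemma weight_mono l k k' : k < k' -> weight l k < weight l k'.
Proof. by rewrite /weight; do !case: ifP => _; lia. Qed.

Lemma weigh_mono w k k' : k < k' -> weigh w k < weigh w k'.
Proof. by move=> lt; elim: w => [//|l w IHw] /=; exact: weight_mono. Qed.

Lemma weigh_cat u v k : weigh (u ++ v) k = weigh u (weigh v k).
Proof. exact: foldr_cat. Qed.

Lemma weigh_erase w k : weigh (word_incl (erase w)) k = weigh w k.
Proof.
elim: w => [//|[x e] w IHw]; have [->|/eqP x0] := eqVneq x ord0.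
  by rewrite erase_ord0 IHw.
by rewrite incl_erase_cons //= IHw.
Qed.

Lemma weight_white (x : dom) (e : bool) k : ~~ col x -> weight (x, e) k <= k.+1.
Proof. by move=> cx; rewrite /weight /= cx; case: ifP. Qed.

Lemma weight_white_neq0 (x : dom) (e : bool) k : x <> ord0 -> ~~ col x -> weight (x, e) k = k.+1.
Proof. by move=> /eqP/negbTE x0 cx; rewrite /weight /= x0 cx. Qed.

Lemma weight_black (x : dom) (e : bool) k : col x -> (e -> ~ outer x) -> weight (x, e) k = 3 * k + 1.
Proof.
move=> cx ox; rewrite /weight /= cx (negbTE (introN eqP (black_neq0 cx))) /=.
by case: e ox => //= /(_ isT) ox; case: asboolP.
Qed.

Lemma weight_outer (x : dom) k : outer x -> weight (x, true) k = 3 * k + 3.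
Proof.
move=> ox; have cx := col_outer ox.
by rewrite /weight /= cx (negbTE (introN eqP (black_neq0 cx))) /=; case: asboolP.
Qed.

Lemma weigh_expand a k : col a -> weigh (expand a) k <= 3 * k + 2.
Proof.
move=> ca; have [oa|oa] := pselect (outer a).
  rewrite expandT //= (weight_black (x := nx a)) //; last exact/col_outer/outer_nx.
  by have := @weight_white (opp a) true (3 * k + 1) (col_opp oa); lia.
by rewrite expandF //= weight_black //; lia.
Qed.

(** The tight cases are [SwapNP] and [SwapNN]: the left-hand side weighs 3k + 4 and the right-hand
    side at most 3k + 3. White letters on the right are only bounded from above, because they may be
    x_0. *)
Lemma weigh_rule2 x y r k : rule2 x y r -> weigh r k < weigh [:: x; y] k.
Proof.
case=> [a b c d oa sq|a b c d d0 sq|a oa|a b c d oa b0 sq|x' e x0 ox] /=.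
- have [ca cb cc cd] := Sq_col sq.
  have b0 : b <> ord0 by move=> b0; rewrite b0 in sq; case: (Sq_outer sq).
  rewrite (weight_white_neq0 _ _ b0) // (weight_black (x := c)) // (weight_black (x := a)) //.
  by have := @weight_white d true (3 * k + 1) cd; lia.
- have [ca cb cc cd] := Sq_col sq.
  rewrite (weight_white_neq0 _ _ d0) // (weight_black (x := a)) //.
  have := @weight_white b false (weigh (expand c) k) cb.
  by have := @weigh_expand c k cc; lia.
- rewrite (weight_black (x := a)) ?col_outer // (weight_black (x := nx a)) //; last exact/col_outer/outer_nx.
  by have := @weight_white (opp a) false k (col_opp oa); lia.
- have [ca cb cc cd] := Sq_col sq.
  rewrite (weight_white_neq0 _ _ b0) // (weight_black (x := c)) // (weight_black (x := nx a)) //; last exact/col_outer/outer_nx.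
  have := @weight_white d true (3 * k + 1) cd.
  by have := @weight_white (opp a) false (weight (d, true) (3 * k + 1)) (col_opp oa); lia.
- have [cx|cx] := boolP (col x'); last by rewrite !weight_white_neq0.
  by rewrite !weight_black //; lia.
Qed.

Lemma weigh_rule l r k : rule l r -> weigh r k < weigh l k.
Proof.
case=> [a oa|x y {}r]; last exact: weigh_rule2.
rewrite /= (weight_outer _ oa) (weight_black (x := nx a)) //; last exact/col_outer/outer_nx.
by have := @weight_white (opp a) true (3 * k + 1) (col_opp oa); lia.
Qed.

Lemma dehn_system_terminating : terminating dehn_system.
Proof.
case=> w step; pose f i := weigh (word_incl (w i)) 0.
have fS i : f i.+1 < f i.
  have [u [l [r [v [lr e ew]]]]] := dehn_system_rewritesP (step i).
  rewrite /f e ew weigh_erase !weigh_cat.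
  exact/weigh_mono/weigh_rule.
have fi i : f i + i <= f 0.
  by elim: i => [|i IHi]; [lia|have := fS i; lia].
by have := fi (f 0).+1; lia.
Qed.

(** Both sides of every rule have at most three letters from a finite alphabet. *)
Lemma dehn_system_finite : finite_set dehn_system.
Proof.
apply: (@sub_finite_set _ _ [set (val p.1, val p.2) |
    p in [set: (3.-bseq (letter 'I_n) * 3.-bseq (letter 'I_n))%type]]).
  move=> [l' r'] [l [r [lr /= -> ->]]].
  have size_erase u : size u <= 3 -> size (erase u) <= 3.
    by apply: leq_trans; rewrite /erase size_pmap count_size.
  have sl : size l <= 3 by case: lr.
  have sr : size r <= 3.
    case: lr => // x y {}r [] //= a b c d _ _.
    by rewrite /expand; case: asboolP.
  by exists (Bseq (size_erase _ sl), Bseq (size_erase _ sr)).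
exact/finite_image/finite_finset.
Qed.

(** ** Agreement with the presentation *)

Variable rels : set word.
Hypothesis rel0 : rels [:: (ord0, true)].
Hypothesis rels_Sq : forall a b c d, Sq a b c d ->
  same_element rels [:: (a, true); (b, false)] [:: (d, true); (c, false)].
Hypothesis relsP : forall r, rels r -> r = [:: (ord0, true)] \/
  exists a b c d, Sq a b c d /\ (r = dehn_relator a b c d \/ r = dehn_relator b a d c).

Local Notation same := (same_element rels).

Lemma same_at u v l r w z :
  same l r -> w = u ++ l ++ v -> same (u ++ r ++ v) z -> same w z.
Proof. by move=> lr ->; apply/rst_trans/rewrites_equiv_cat. Qed.

Lemma same_refl u : same u u. Proof. exact: rst_refl. Qed.

Lemma same_sym u v : same u v -> same v u. Proof. exact: rst_sym. Qed.

Lemma same_cancel x e : same [:: (x, e); (x, ~~ e)] [::].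
Proof. by apply/rst_step/rewrites_rule; right; exists x, e. Qed.

Lemma same_ord0 e : same [:: (ord0, e)] [::].
Proof.
have same0 : same [:: (ord0, true)] [::] by apply/rst_step/rewrites_rule; left.
case: e => //; apply: rst_trans (same_cancel ord0 true).
exact/rst_sym/(same_at (u := [::]) (v := [:: (ord0, false)]) same0 erefl (same_refl _)).
Qed.

Lemma same_move x e u v : same ((x, e) :: u) v -> same u ((x, ~~ e) :: v).
Proof.
move=> uv; apply: (@rst_trans _ _ _ ((x, ~~ e) :: (x, e) :: u)).
  apply: rst_sym; rewrite -{2}(negbK e).
  exact: (same_at (u := [::]) (v := u) (same_cancel x (~~ e)) erefl (same_refl _)).
apply: (same_at (u := [:: (x, ~~ e)]) (v := [::]) uv); rewrite ?cats0 //=.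
exact: same_refl.
Qed.

Lemma same_erase w : same (word_incl (erase w)) w.
Proof.
elim: w => [|[x e] w IHw]; first exact: same_refl.
have [->|/eqP x0] := eqVneq x ord0.
  rewrite erase_ord0; apply: rst_trans IHw _; apply: rst_sym.
  exact: (same_at (u := [::]) (v := w) (same_ord0 e) erefl (same_refl _)).
rewrite incl_erase_cons //; apply: (same_at (u := [:: (x, e)]) (v := [::]) IHw).
  by rewrite cats0.
by rewrite cats0; exact: same_refl.
Qed.

Lemma same_Sq_NP a b c d : Sq a b c d ->
  same [:: (a, false); (d, true)] [:: (b, false); (c, true)].
Proof.
move=> /rels_Sq/same_move/(@same_at [::] [:: (c, true)]) E; apply: rst_sym.
apply: E erefl _.
exact: (same_at (u := [:: (a, false); (d, true)]) (v := [::]) (same_cancel c false) erefl (same_refl _)).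
Qed.

Lemma same_outer a : outer a -> same [:: (a, true)] [:: (opp a, true); (nx a, false)].
Proof.
move=> /outerP/rels_Sq E; apply: rst_trans E; apply: rst_sym.
exact: (same_at (u := [:: (a, true)]) (v := [::]) (same_ord0 false) erefl (same_refl _)).
Qed.

Lemma same_expand a : same (expand a) [:: (a, true)].
Proof.
have [oa|oa] := pselect (outer a); last by rewrite expandF //; exact: same_refl.
by rewrite expandT //; exact/rst_sym/same_outer.
Qed.

Lemma same_rule l r : rule l r -> same l r.
Proof.
case=> [a|x y {}r]; first exact: same_outer.
have same_nx a : outer a -> same [:: (nx a, false)] [:: (opp a, false); (a, true)].
  by move=> /same_outer/same_sym/same_move.
case=> [a b c d _|a b c d _ sq|a oa|a b c d oa _ sq|x' e _ _].
- exact: rels_Sq.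
- apply: rst_trans (same_Sq_NP sq) _; apply: rst_sym.
  apply: (same_at (u := [:: (b, false)]) (v := [::]) (same_expand c)); first by rewrite cats0.
  exact: same_refl.
- apply: (same_at (u := [::]) (v := [:: (a, false)]) (same_nx a oa) erefl).
  exact: (same_at (u := [:: (opp a, false)]) (v := [::]) (same_cancel a true) erefl (same_refl _)).
- apply: (same_at (u := [::]) (v := [:: (b, false)]) (same_nx a oa) erefl).
  exact: (same_at (u := [:: (opp a, false)]) (v := [::]) (rels_Sq sq) erefl (same_refl _)).
- exact: same_cancel.
Qed.

Lemma red_Sq a b c d : Sq a b c d ->
  red [:: (a, true); (b, false)] [:: (d, true); (c, false)].
Proof.
move=> sq; apply: (red_at (u := [::]) (v := [:: (b, false)]) (red_expand a) erefl).
exact: red_expand_swap.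
Qed.

Lemma red_equiv u v : red u v -> rewrites_equiv dehn_system (erase u) (erase v).
Proof. exact: rewrites_star_equiv. Qed.

Lemma rels_equiv r : rels r -> rewrites_equiv dehn_system (erase r) (erase [::]).
Proof.
have red_dcN c d : red [:: (d, true); (c, false); (c, true); (d, false)] [::].
  apply: (red_at (u := [:: (d, true)]) (v := [:: (d, false)]) (red_cancel c false) erefl).
  exact: (red_cancel d true).
move=> /relsP[->|[a [b [c [d [sq [->|->]]]]]]].
- exact/red_equiv/red_ord0.
- apply: red_equiv.
  exact: (red_at (u := [::]) (v := [:: (c, true); (d, false)]) (red_Sq sq) erefl (red_dcN _ _)).
(* The word c d^-1 d c^-1 reduces both to this relator b a^-1 d c^-1 and to the empty word. *)
- apply: rst_trans (red_equiv (red_dcN d c)); apply/rst_sym/red_equiv.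
  exact: (red_at (u := [::]) (v := [:: (d, true); (c, false)]) (red_Sq (Sq_rot sq)) erefl (red_refl _)).
Qed.

(** A derivation in the presentation may pass through words containing x_0; [erase] turns each of
    its steps into an equivalence of the system. *)
Lemma dehn_system_same u v : rewrites_equiv dehn_system u v <->
  same_element rels (word_incl u) (word_incl v).
Proof.
split=> [|uv].
  elim=> [{}u {}v|w|w w' _ ww'|w1 w2 w3 _ w12 _ w23].
  - move=> /dehn_system_rewritesP[u1 [l [r [v1 [lr -> ->]]]]].
    apply: (@rst_trans _ _ _ (u1 ++ r ++ v1)); last exact/rst_sym/same_erase.
    exact/rewrites_equiv_cat/same_rule.
  - exact: rst_refl.
  - exact: rst_sym.
  - exact: rst_trans w12 w23.
rewrite -(erase_incl u) -(erase_incl v).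
elim: uv => [w w'|w|w w' _ ww'|w1 w2 w3 _ w12 _ w23].
- case=> u1 [v1 [l [r [lr -> ->]]]]; rewrite !erase_cat; apply: rewrites_equiv_cat.
  case: lr => [[/= rl ->]|[i [e [-> ->]]]]; first exact: rels_equiv.
  exact/red_equiv/red_cancel.
- exact: rst_refl.
- exact: rst_sym.
- exact: rst_trans w12 w23.
Qed.

End DehnRewriting.

(** * From labelled crossings to coloured squares *)

Section CrossingData.
Variables (n m : nat) (a b c d : 'I_m -> 'I_n.+1) (col : 'I_n.+1 -> bool).

Definition over_pair j (u v : 'I_n.+1) : bool :=
  (u, v) \in [:: (a j, b j); (b j, a j); (c j, d j); (d j, c j)].

Definition under_pair j (u v : 'I_n.+1) : bool :=
  (u, v) \in [:: (a j, d j); (d j, a j); (b j, c j); (c j, b j)].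

(** The four tuples are the admissible labellings of one crossing, two in each sense of rotation;
    the colour of [u] retains those that begin at a black domain. *)
Definition black_square (u v w z : 'I_n.+1) : Prop :=
  col u /\ exists j, (u, v, w, z) \in
    [:: (a j, b j, c j, d j); (c j, d j, a j, b j);
        (b j, a j, d j, c j); (d j, c j, b j, a j)].

Hypothesis distinct : forall j, uniq [:: a j; b j; c j; d j].
Hypothesis col_ab : forall j, col (a j) != col (b j).
Hypothesis col_bc : forall j, col (b j) != col (c j).
Hypothesis col_ad : forall j, col (a j) != col (d j).
Hypothesis over_inj : forall j j' u v, over_pair j u v -> over_pair j' u v -> j = j'.
Hypothesis under_inj : forall j j' u v, under_pair j u v -> under_pair j' u v -> j = j'.
Hypothesis over_under : forall u v,
  (exists j, over_pair j u v) <-> (exists j, under_pair j u v).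

Lemma black_squareP u v w z : black_square u v w z -> exists j,
  [/\ over_pair j u v, under_pair j u z, col u &
    (u, v, w, z) \in [:: (a j, b j, c j, d j); (c j, d j, a j, b j);
        (b j, a j, d j, c j); (d j, c j, b j, a j)]].
Proof.
case=> cu [j juvwz]; exists j; split=> //; move: juvwz; rewrite !inE => /or4P[] /eqP[? ? ? ?]; subst;
  by rewrite /over_pair /under_pair !inE eqxx ?orbT.
Qed.

Lemma distinctP j : [/\ a j <> b j, a j <> c j, a j <> d j, b j <> c j & b j <> d j /\ c j <> d j].
Proof.
have := distinct j; rewrite /= !inE !negb_or !andbT.
by case/and3P=> /and3P[/eqP ? /eqP ? /eqP ?] /andP[/eqP ? /eqP ?] /eqP ?.
Qed.

Lemma black_square_over u v w z w' z' : black_square u v w z -> black_square u v w' z' ->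
  w = w' /\ z = z'.
Proof.
move=> /black_squareP[j [ov _ _ sq]] /black_squareP[j' [ov' _ _ sq']].
have ? := over_inj ov ov'; subst j'; have [ab ac ad bc [bd cd]] := distinctP j.
move: sq sq'; rewrite !inE => /or4P[] /eqP[? ? ? ?] /or4P[] /eqP[? ? ? ?]; subst;
  by split=> //; congruence.
Qed.

Lemma black_square_under u v w z v' w' : black_square u v w z -> black_square u v' w' z ->
  v = v' /\ w = w'.
Proof.
move=> /black_squareP[j [_ ov _ sq]] /black_squareP[j' [_ ov' _ sq']].
have ? := under_inj ov ov'; subst j'; have [ab ac ad bc [bd cd]] := distinctP j.
move: sq sq'; rewrite !inE => /or4P[] /eqP[? ? ? ?] /or4P[] /eqP[? ? ? ?]; subst;
  by split=> //; congruence.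
Qed.

Lemma black_square_col u v w z : black_square u v w z ->
  [/\ col u, ~~ col v, col w & ~~ col z].
Proof.
case=> cu [j]; have := col_ab j; have := col_bc j; have := col_ad j.
rewrite !inE => + + + /or4P[] /eqP[? ? ? ?]; subst;
  by move: cu; case: (col _) => //; case: (col _); case: (col _); case: (col _).
Qed.

Lemma black_square_rot u v w z : black_square u v w z -> black_square w z u v.
Proof.
move=> sq; have [_ _ cw _] := black_square_col sq; split=> //; have [_ [j juvwz]] := sq.
by exists j; move: juvwz; rewrite !inE => /or4P[] /eqP[-> -> -> ->]; rewrite eqxx ?orbT.
Qed.

Lemma black_square_neq u v w z : black_square u v w z -> v <> z.
Proof.
case=> cu [j]; have [ab ac ad bc [bd cd]] := distinctP j.
by rewrite !inE => /or4P[] /eqP[? ? ? ?]; subst => //; apply: nesym.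
Qed.

(** Any pair of domains separated by a strand at a crossing extends to a labelling starting at its
    first member, so [over_under] passes from pairs to squares. *)
Lemma black_square_edge u v : (exists w z, black_square u v w z) <->
  (exists w z, black_square u w z v).
Proof.
split=> [[w [z]]|[w [z]]] /black_squareP[j [ov un cu _]].
  have [j' ] : exists j, under_pair j u v by apply/over_under; exists j.
  rewrite /under_pair !inE => /or4P[] /eqP[? ?]; subst u v;
    [exists (b j'), (c j')|exists (c j'), (b j')|exists (a j'), (d j')|exists (d j'), (a j')];
    by split=> //; exists j'; rewrite !inE eqxx ?orbT.
have [j' ] : exists j, over_pair j u v by apply/over_under; exists j.
rewrite /over_pair !inE => /or4P[] /eqP[? ?]; subst u v;
  [exists (c j'), (d j')|exists (d j'), (c j')|exists (a j'), (b j')|exists (b j'), (a j')];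
  by split=> //; exists j'; rewrite !inE eqxx ?orbT.
Qed.

Lemma same_dehn_relator j : same_element (dehn_relators a b c d)
  (dehn_relator (a j) (b j) (c j) (d j)) [::].
Proof. by apply/rst_step/rewrites_rule; left; split=> //; left; exists j. Qed.

Lemma same_dehn_cd j : same_element (dehn_relators a b c d)
  [:: (c j, true); (d j, false)] [:: (b j, true); (a j, false)].
Proof. by have /same_move/same_move := same_dehn_relator j. Qed.

Lemma same_dehn_ab j : same_element (dehn_relators a b c d)
  [:: (a j, true); (b j, false)] [:: (d j, true); (c j, false)].
Proof.
have /same_move/same_move/=/same_sym E := same_dehn_cd j.
(* Here a b^-1 is appended to d c^-1 b a^-1 = 1, and the last four letters of the result cancel. *)
have {}E := same_at (u := [::]) (v := [:: (a j, true); (b j, false)]) E erefl (same_refl _ _).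
apply: rst_trans (same_sym E) _ => /=.
apply: (same_at (u := [:: (d j, true); (c j, false); (b j, true)]) (v := [:: (b j, false)])
  (same_cancel _ (a j) false) erefl).
exact: (same_at (u := [:: (d j, true); (c j, false)]) (v := [::])
  (same_cancel _ (b j) true) erefl (same_refl _ _)).
Qed.

Lemma black_square_same u v w z : black_square u v w z ->
  same_element (dehn_relators a b c d) [:: (u, true); (v, false)] [:: (z, true); (w, false)].
Proof.
case=> _ [j]; rewrite !inE => /or4P[] /eqP[? ? ? ?]; subst.
- exact: same_dehn_ab.
- exact: same_dehn_cd.
- exact/same_sym/same_dehn_cd.
- exact/same_sym/same_dehn_ab.
Qed.

Lemma black_square_relators r : dehn_relators a b c d r -> r = [:: (ord0, true)] \/
  exists u v w z, black_square u v w z /\ (r = dehn_relator u v w z \/ r = dehn_relator v u z w).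
Proof.
case=> [[j ->]|->]; last by left.
right; have := col_ab j; have [ca|ca] := boolP (col (a j)); move=> cb.
  exists (a j), (b j), (c j), (d j); split; last by left.
  by split=> //; exists j; rewrite !inE eqxx.
exists (b j), (a j), (d j), (c j); split; last by right.
by split; [move: cb; case: (col (b j))|exists j; rewrite !inE eqxx ?orbT].
Qed.

Hypothesis col0 : col ord0 = false.

Lemma coloured_complete_rewriting :
  exists RR : set (seq (letter 'I_n) * seq (letter 'I_n)),
  [/\ rewriting_system_for_dehn a b c d RR, complete_rewriting RR & finite_set RR].
Proof.
exists (dehn_system black_square); split.
- move=> u v; refine (dehn_system_same col0 black_square_rot black_square_col
    black_square_neq black_square_over (black_square_edge^~ ord0) _ _ _ u v).
  + by right.
  + exact: black_square_same.
  + exact: black_square_relators.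
- split; first exact: (dehn_system_terminating col0 black_square_rot black_square_col
    black_square_over (black_square_edge^~ ord0)).
  exact: (dehn_system_confluent col0 black_square_rot black_square_col black_square_neq
    black_square_over black_square_under (black_square_edge^~ ord0)).
- exact: dehn_system_finite.
Qed.

End CrossingData.

Lemma checkerboard_complete_rewriting (n m : nat) (a b c d : 'I_m -> 'I_n.+1)
    (col : 'I_n.+1 -> bool) :
  (forall j, uniq [:: a j; b j; c j; d j]) ->
  (forall j, col (a j) != col (b j)) ->
  (forall j, col (b j) != col (c j)) ->
  (forall j, col (a j) != col (d j)) ->
  (forall j j' u v, over_pair a b c d j u v -> over_pair a b c d j' u v -> j = j') ->
  (forall j j' u v, under_pair a b c d j u v -> under_pair a b c d j' u v -> j = j') ->
  (forall u v, (exists j, over_pair a b c d j u v) <-> (exists j, under_pair a b c d j u v)) ->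
  exists RR : set (seq (letter 'I_n) * seq (letter 'I_n)),
  [/\ rewriting_system_for_dehn a b c d RR, complete_rewriting RR & finite_set RR].
Proof.
move=> uq ab bc ad ov un ou; have [c0|c0] := boolP (col ord0); last first.
  exact: (coloured_complete_rewriting uq ab bc ad ov un ou (negbTE c0)).
(* If x_0 is black, the two colours are exchanged. *)
apply: (@coloured_complete_rewriting _ _ _ _ _ _ (fun i => ~~ col i)) => //; last by rewrite c0.
- by move=> j; rewrite (inj_eq negb_inj).
- by move=> j; rewrite (inj_eq negb_inj).
- by move=> j; rewrite (inj_eq negb_inj).
Qed.

Local Open Scope ring_scope.

(** * Connectedness in the plane *)

(** [U] carries no topology: the fibre of [f x] is shown to be relatively open and relatively closed
    in [A] directly. *)
Lemma connected_locally_constant (T : topologicalType) (U : Type) (A : set T) (f : T -> U) :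
  connected A -> (forall z, A z -> \forall w \near z, A w -> f w = f z) ->
  forall x y, A x -> A y -> f x = f y.
Proof.
move=> cA fA x y Ax Ay.
suff: A `&` [set w | f w = f x] = A by move=> /esym/seteqP[/(_ y Ay)[_ ->]].
apply: cA; first by exists x.
  exists [set w | A w -> f w = f x]°; first exact: open_interior.
  apply/seteqP; split=> z /= [Az].
    by move=> <-; split=> //; exact: fA.
  by move=> /nbhs_singleton/(_ Az).
exists (~` [set w | A w -> f w <> f x]°); first exact/open_closedC/open_interior.
apply/seteqP; split=> z /= [Az].
  by move=> fz; split=> // /nbhs_singleton/(_ Az).
move=> nz; split=> //; apply: contrapT => fz; apply: nz.
by apply: filterS (fA z Az) => w fw /fw ->.
Qed.

Section Rectangles.
Variable R : realType.
Local Notation pt := (R * R)%type.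
Implicit Types (z w q : pt) (U V S T : set pt).

Definition rect (a b c d : R) : set pt := [set q | a < q.1 < b /\ c < q.2 < d].

Lemma rect_open a b c d : open (rect a b c d).
Proof.
rewrite openE => -[x y] [/= xab ycd].
exists ([set` `]a, b[], [set` `]c, d[]) => /=.
  by split; apply: near_in_itvoo; rewrite in_itv.
by move=> [u v] [/=]; rewrite !in_itv.
Qed.

Lemma nbhs_rect z U : nbhs z U ->
  exists2 e, 0 < e & rect (z.1 - e) (z.1 + e) (z.2 - e) (z.2 + e) `<=` U.
Proof.
move=> /nbhs_ballP[e /= e0 zU]; exists e => // w [w1 w2]; apply: zU.
by split; rewrite /= -ball_normE /= ltr_norml; lra.
Qed.

Lemma rect_nbhs a b c d z : rect a b c d z -> nbhs z (rect a b c d).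
Proof. by move=> rz; apply: open_nbhs_nbhs; split=> //; exact: rect_open. Qed.

(** The product is the union of crosses, each formed by one vertical fibre and a fixed horizontal
    slice, and all crosses share a point of that slice. *)
Lemma connected_setX (T1 T2 : topologicalType) (A : set T1) (B : set T2) :
  connected A -> connected B -> connected (A `*` B).
Proof.
move=> cA cB.
have [->|/set0P[b Bb]] := eqVneq B set0; first by rewrite setX0; exact: connected0.
have -> : A `*` B = \bigcup_(x in A) ((fun y => (x, y)) @` B `|` (fun x => (x, b)) @` A).
  apply/seteqP; split=> [[x y] [/= Ax By]|_ [x Ax [[y By <-]|[x' Ax' <-]]]]; last 2 first.
  - by split.
  - by split.
  by exists x => //; left; exists y.
have [->|/set0P[a Aa]] := eqVneq A set0; first by rewrite bigcup_set0; exact: connected0.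
apply: bigcup_connected; first by exists (a, b) => x Ax /=; right; exists a.
move=> x Ax; apply: connectedU.
- by exists (x, b); split; [exists b|exists x].
- apply: connected_continuous_connected => //; apply: continuous_subspaceT => y.
  by apply: cvg_pair; [exact: cvg_cst|exact: cvg_id].
- apply: connected_continuous_connected => //; apply: continuous_subspaceT => y.
  by apply: cvg_pair; [exact: cvg_id|exact: cvg_cst].
Qed.

Lemma rect_connected a b c d : connected (rect a b c d).
Proof.
have -> : rect a b c d = [set` `]a, b[] `*` [set` `]c, d[].
  by apply/seteqP; split=> q; rewrite /rect /= /setX /= !in_itv.
by apply: connected_setX; apply/connected_intervalP; exact: interval_is_interval.
Qed.

End Rectangles.

(** * The two sides of an arc *)

Section TwoSides.
Variable R : realType.
Variable P : set (R * R).
Local Notation pt := (R * R)%type.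
Implicit Types (z w q : pt) (U V S T : set pt) (psi : pt -> pt).

(** [S] and [T] are the sides of the arc [P] inside [V]; the closure conditions say that both sides
    accumulate at every point of the arc. *)
Record two_sided V S T : Prop := {
  side_open : open V;
  side_connected1 : connected S;
  side_connected2 : connected T;
  side_cover : V `\` P = S `|` T;
  side_closure1 : V `&` P `<=` closure S;
  side_closure2 : V `&` P `<=` closure T }.

Lemma embedding_nbhs psi q U : open_embedding psi -> nbhs q U -> nbhs (psi q) (psi @` U).
Proof.
case=> _ _ opsi; rewrite nbhsE => -[V [oV Vq] VU]; rewrite nbhsE.
by exists (psi @` V); [split; [exact: opsi|exists q]|exact: image_subset].
Qed.

Lemma embedding_connected psi U : open_embedding psi -> connected U -> connected (psi @` U).
Proof.
case=> cpsi _ _ cU; apply: connected_continuous_connected => //.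
exact: continuous_subspaceT.
Qed.

Lemma embedding_closure psi q U : open_embedding psi -> closure U q -> closure (psi @` U) (psi q).
Proof.
case=> cpsi _ _ clU V /cpsi/clU[w [Uw Vw]].
by exists (psi w); split=> //; exists w.
Qed.

Lemma rect_closure a b c d q : a < b -> c < d -> a <= q.1 <= b -> c <= q.2 <= d ->
  closure (rect a b c d) q.
Proof.
move=> ab cd q1 q2 V /nbhs_rect[e e0 eV].
have pick (u v t : R) : u < v -> u <= t <= v -> exists2 s, u < s < v & t - e < s < t + e.
  move=> uv /andP[ut tv']; have [tv|vt] := ltP t v.
    have [ev|ve] := ltP e (v - t); first by exists (t + e / 2); lra.
    by exists ((t + v) / 2); lra.
  have [ev|ve] := ltP e (v - u); first by exists (t - e / 2); lra.
  by exists ((u + v) / 2); lra.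
have [x abx ex] := pick _ _ _ ab q1; have [y cdy ey] := pick _ _ _ cd q2.
by exists (x, y); split=> //; exact: eV.
Qed.

Lemma chart_two_sided psi a b c d : open_embedding psi -> a < b -> c < 0 < d ->
  (forall q, rect a b c d q -> P (psi q) <-> q.2 = 0) ->
  two_sided (psi @` rect a b c d) (psi @` rect a b 0 d) (psi @` rect a b c 0).
Proof.
move=> epsi ab cd Ppsi; split.
- by case: epsi => _ _; apply; exact: rect_open.
- exact/embedding_connected/rect_connected.
- exact/embedding_connected/rect_connected.
- apply/seteqP; split=> [_ [[q rq <-]]|_ [[q rq <-]|[q rq <-]]].
  + rewrite Ppsi // => /eqP; rewrite neq_lt => /orP[q0|q0]; [right|left]; exists q => //;
      by case: rq => q1 /andP[? ?]; split=> //; apply/andP.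
  + have rq' : rect a b c d q by case: rq => q1 q2; split=> //; lra.
    by split; [exists q|rewrite Ppsi // => q0; case: rq => _; rewrite q0 ltxx].
  + have rq' : rect a b c d q by case: rq => q1 q2; split=> //; lra.
    by split; [exists q|rewrite Ppsi // => q0; case: rq => _; rewrite q0 ltxx andbF].
- move=> _ [[q rq <-]]; rewrite Ppsi // => q0; apply: embedding_closure => //.
  by case: rq => q1 q2; apply: rect_closure; lra.
- move=> _ [[q rq <-]]; rewrite Ppsi // => q0; apply: embedding_closure => //.
  by case: rq => q1 q2; apply: rect_closure; lra.
Qed.

End TwoSides.

(** * Checkerboard colourings *)

Section Colouring.
Variable R : realType.
Local Notation pt := (R * R)%type.
Implicit Types (z w q : pt) (O U V S T : set pt) (psi : pt -> pt) (g h : pt -> bool).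
Variables P M : set pt.
Hypothesis P_closed : closed P.
Hypothesis M_finite : finite_set M.
Hypothesis P_arc : forall z, P z -> ~ M z -> exists psi, [/\ open_embedding psi,
  psi (0, 0) = z & psi @^-1` P = [set q | q.2 = 0]].
Hypothesis P_crossing : forall z, M z -> exists psi, [/\ open_embedding psi,
  psi (0, 0) = z & psi @^-1` P = [set q | q.1 = 0 \/ q.2 = 0]].

Lemma plane_hausdorff : hausdorff_space pt.
Proof. exact: norm_hausdorff. Qed.

Lemma M_isolated z : \forall w \near z, M w -> w = z.
Proof.
have /closed_openC oC : closed (M `\ z).
  have [+ _] := @accessible_finite_set_closed pt.
  move=> /(_ (hausdorff_accessible plane_hausdorff)); apply; exact: finite_setD.
have : nbhs z (~` (M `\ z)) by apply: open_nbhs_nbhs; split=> // -[_]; apply.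
by apply: filterS => w nw Mw; apply: contrapT => wz; exact: nw.
Qed.

Lemma embedding_rect psi U : open_embedding psi -> nbhs (psi (0, 0)) U ->
  exists2 e : R, 0 < e & psi @` rect (- e) e (- e) e `<=` U.
Proof.
case=> cpsi _ _ /cpsi/nbhs_rect[e e0]; rewrite /= !sub0r !add0r => eU.
by exists e => // _ [q /eU Uq <-].
Qed.

Lemma arc_two_sided z U : P z -> ~ M z -> nbhs z U ->
  exists V S T, [/\ V `<=` U, V z & two_sided P V S T].
Proof.
move=> Pz Mz Uz; have [psi [epsi psi0 psiP]] := P_arc Pz Mz.
rewrite -psi0 in Uz; have [e e0 eU] := embedding_rect epsi Uz.
exists (psi @` rect (- e) e (- e) e), (psi @` rect (- e) e 0 e), (psi @` rect (- e) e (- e) 0).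
split=> //.
  by exists (0, 0) => //; rewrite /rect /=; lra.
apply: chart_two_sided => //; [lra|lra|move=> q _].
by rewrite -[P (psi q)]/((psi @^-1` P) q) psiP.
Qed.

(** The change of colour across an arc is expressed by asking for both colours in every
    neighbourhood, without naming the sides. A point of [M] is constrained only through the points
    near it. *)
Definition good_at g z : Prop :=
  (~ P z -> \forall w \near z, g w = g z) /\
  (P z -> ~ M z -> forall U, nbhs z U ->
    exists u v, [/\ U u, U v, ~ P u, ~ P v & g u <> g v]).

Definition colouring O g : Prop := forall z, O z -> good_at g z.

Definition colourable O : Prop := exists g, colouring O g.

Lemma good_at_eq g h z : (\forall w \near z, ~ P w -> g w = h w) ->
  good_at h z -> good_at g z.
Proof.
move=> gh [h1 h2]; split=> [Pz|Pz Mz U Uz].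
  have oP : nbhs z (~` P) by apply: open_nbhs_nbhs; split=> //; exact: closed_openC.
  have ghz := nbhs_singleton gh Pz.
  by apply: filterS3 gh oP (h1 Pz) => w gw Pw hw; rewrite gw // hw ghz.
have [u [v [[Uu gu] [Uv gv] Pu Pv hn]]] := h2 Pz Mz _ (filterI Uz gh).
by exists u, v; split=> //; rewrite gu // gv.
Qed.

Lemma good_at_addb g c z : good_at g z -> good_at (fun w => g w (+) c) z.
Proof.
case=> g1 g2; split=> [Pz|Pz Mz U Uz]; first by apply: filterS (g1 Pz) => w ->.
have [u [v [Uu Uv Pu Pv n]]] := g2 Pz Mz U Uz.
by exists u, v; split=> // /addIb.
Qed.

Lemma colouring_connected g A : connected A ->
  (forall z, A z -> ~ P z /\ good_at g z) -> forall x y, A x -> A y -> g x = g y.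
Proof.
move=> cA gA; apply: connected_locally_constant => // z /gA[Pz [/(_ Pz) + _]].
by apply: filterS => w.
Qed.

(** Each side is connected and avoids [P], so it has one colour; since both colours occur in [V] off
    [P], the two sides differ. *)
Lemma two_sided_colours g V S T z : two_sided P V S T -> V z -> P z -> ~ M z ->
  colouring V g -> exists s, (forall w, S w -> g w = s) /\ (forall w, T w -> g w = ~~ s).
Proof.
move=> [oV cS cT VST clS clT] Vz Pz Mz gV.
have Vnz : nbhs z V by apply: open_nbhs_nbhs.
have [x [Sx _]] := clS z (conj Vz Pz) V Vnz.
have [y [Ty _]] := clT z (conj Vz Pz) V Vnz.
have VP w : S w \/ T w -> ~ P w /\ good_at g w.
  by move=> STw; have [Vw Pw] : (V `\` P) w by [rewrite VST]; split=> //; exact: gV.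
have gS w : S w -> g w = g x.
  by move=> Sw; apply: (colouring_connected cS) => // u Su; apply: VP; left.
have gT w : T w -> g w = g y.
  by move=> Tw; apply: (colouring_connected cT) => // u Tu; apply: VP; right.
exists (g x); split=> // w /gT ->.
have [u [v [Vu Vv Pu Pv]]] := (gV z Vz).2 Pz Mz V Vnz.
have : (S `|` T) u by rewrite -VST. have : (S `|` T) v by rewrite -VST.
by move=> [/gS ->|/gT ->] [/gS ->|/gT ->] //; case: (g x); case: (g y).
Qed.

Lemma P_dense z U : nbhs z U -> exists2 w, U w & ~ P w.
Proof.
move=> Uz; have [Pz|Pz] := pselect (P z); last by exists z => //; exact: nbhs_singleton.
have [Mz|Mz] := pselect (M z).
  have [psi [epsi psi0 psiP]] := P_crossing Mz; rewrite -psi0 in Uz.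
  have [e e0 eU] := embedding_rect epsi Uz.
  exists (psi (e / 2, e / 2)).
    by apply: eU; exists (e / 2, e / 2) => //; rewrite /rect /=; lra.
  rewrite -[P _]/((psi @^-1` P) (e / 2, e / 2)) psiP /= => -[]; lra.
have [V [S [T [VU Vz [oV _ _ VST clS _]]]]] := arc_two_sided Pz Mz Uz.
have [w [Sw Vw]] := clS z (conj Vz Pz) V (open_nbhs_nbhs (conj oV Vz)).
by have [_ Pw] : (V `\` P) w by [rewrite VST; left]; exists w => //; exact: VU.
Qed.

Definition flat (f : pt -> bool) z c : Prop := \forall w \near z, ~ P w -> f w = c.

Lemma flat_closure f z c A k : flat f z c -> closure A z -> A `<=` ~` P ->
  (forall w, A w -> f w = k) -> k = c.
Proof. by move=> fz /(_ _ fz)[w [Aw fw]] AP fA; rewrite -(fA w) // fw //; exact: AP. Qed.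

(** Both colourings change across an arc, so their sum modulo 2 does not. *)
Lemma flat_diff_simple O g h z : open O -> O z -> colouring O g -> colouring O h ->
  ~ M z -> exists c, flat (fun w => g w (+) h w) z c.
Proof.
move=> oO Oz gO hO Mz; have Onz : nbhs z O by apply: open_nbhs_nbhs.
have [Pz|Pz] := pselect (P z); last first.
  exists (g z (+) h z).
  by apply: filterS2 ((gO z Oz).1 Pz) ((hO z Oz).1 Pz) => w -> ->.
have [V [S [T [VO Vz ts]]]] := arc_two_sided Pz Mz Onz.
have gV : colouring V g by move=> w /VO/gO.
have hV : colouring V h by move=> w /VO/hO.
have [s [gS gT]] := two_sided_colours ts Vz Pz Mz gV.
have [t [hS hT]] := two_sided_colours ts Vz Pz Mz hV.
exists (s (+) t); have : nbhs z V by apply: open_nbhs_nbhs; split=> //; case: ts.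
apply: filterS => w Vw Pw.
have [Sw|Tw] : (S `|` T) w by rewrite -(side_cover ts).
  by rewrite gS // hS.
by rewrite gT // hT //; case: (s); case: (t).
Qed.

(** At a crossing the sum is constant on each quadrant, and neighbouring quadrants have a simple
    point of their common half-axis in both closures, where the sum is already flat. *)
Lemma flat_diff O g h z : open O -> O z -> colouring O g -> colouring O h ->
  exists c, flat (fun w => g w (+) h w) z c.
Proof.
move=> oO Oz gO hO; have [Mz|/(flat_diff_simple oO Oz gO hO)//] := pselect (M z).
set f := fun w => _; have [psi [epsi psi0 psiP]] := P_crossing Mz.
(* The neighbourhood is shrunk until [z] is its only point of [M], so that all other points of the
   axes are simple. *)
have Onz : nbhs (psi (0, 0)) (O `&` [set w | M w -> w = z]).
  by rewrite psi0; apply: filterI; [exact: open_nbhs_nbhs|exact: M_isolated].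
have [e e0 eO] := embedding_rect epsi Onz.
have Ppsi q : P (psi q) <-> (q.1 = 0 \/ q.2 = 0).
  by rewrite -[P (psi q)]/((psi @^-1` P) q) psiP.
have inO (a b c d : R) : - e <= a -> b <= e -> - e <= c -> d <= e -> forall q, rect a b c d q ->
    O (psi q) /\ (M (psi q) -> psi q = z).
  by move=> ? ? ? ? q rq; apply: eO; exists q => //; case: rq => ? ?; split; lra.
have quadrant (a b c d : R) : - e <= a -> b <= e -> - e <= c -> d <= e -> a < b -> c < d ->
    (0 <= a \/ b <= 0) -> (0 <= c \/ d <= 0) ->
    psi @` rect a b c d `<=` ~` P /\
    exists k, forall w, (psi @` rect a b c d) w -> f w = k.
  move=> ea be ec de ab cd ab0 cd0.
  have offP : psi @` rect a b c d `<=` ~` P.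
    by move=> _ [q [q1 q2] <-] /Ppsi; lra.
  split=> //; pose q := ((a + b) / 2, (c + d) / 2).
  exists (f (psi q)) => w Aw.
  have cA : connected (psi @` rect a b c d) by exact/embedding_connected/rect_connected.
  have Aq : (psi @` rect a b c d) (psi q) by exists q => //; rewrite /rect /=; lra.
  have AO v : (psi @` rect a b c d) v -> O v by move=> [u /inO[]// + _ <-].
  congr (_ (+) _); apply: (colouring_connected cA) => // v Av; split=> //; try exact: offP.
    exact/gO/AO.
  exact/hO/AO.
have axis q : rect (- e) e (- e) e q -> (q.1 = 0 \/ q.2 = 0) -> q <> (0, 0) ->
    exists c, flat f (psi q) c.
  move=> rq q0 qn; have [Oq Mq] := inO _ _ _ _ (lexx _) (lexx _) (lexx _) (lexx _) q rq.
  apply: (flat_diff_simple oO) => // /Mq; rewrite -psi0; case: (epsi) => _ + _.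
  by move=> /[apply].
have [pp [k kP]] : psi @` rect 0 e 0 e `<=` ~` P /\
    exists k, forall w, (psi @` rect 0 e 0 e) w -> f w = k by apply: quadrant; lra.
have [pn [k2 k2P]] : psi @` rect 0 e (- e) 0 `<=` ~` P /\
    exists k, forall w, (psi @` rect 0 e (- e) 0) w -> f w = k by apply: quadrant; lra.
have [np [k3 k3P]] : psi @` rect (- e) 0 0 e `<=` ~` P /\
    exists k, forall w, (psi @` rect (- e) 0 0 e) w -> f w = k by apply: quadrant; lra.
have [nn [k4 k4P]] : psi @` rect (- e) 0 (- e) 0 `<=` ~` P /\
    exists k, forall w, (psi @` rect (- e) 0 (- e) 0) w -> f w = k by apply: quadrant; lra.
have cl (a b c d : R) q : a < b -> c < d -> a <= q.1 <= b -> c <= q.2 <= d ->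
    closure (psi @` rect a b c d) (psi q).
  by move=> ab cd q1 q2; apply: embedding_closure => //; exact: rect_closure.
have k2k : k2 = k.
  have [c fc] : exists c, flat f (psi (e / 2, 0)) c.
    by apply: axis; [rewrite /rect /=; lra|right|case; lra].
  rewrite (flat_closure fc _ pn k2P); last by apply: cl => /=; lra.
  by rewrite (flat_closure fc _ pp kP) //; apply: cl => /=; lra.
have k3k : k3 = k.
  have [c fc] : exists c, flat f (psi (0, e / 2)) c.
    by apply: axis; [rewrite /rect /=; lra|left|case; lra].
  rewrite (flat_closure fc _ np k3P); last by apply: cl => /=; lra.
  by rewrite (flat_closure fc _ pp kP) //; apply: cl => /=; lra.
have k4k : k4 = k3.
  have [c fc] : exists c, flat f (psi (- (e / 2), 0)) c.
    by apply: axis; [rewrite /rect /=; lra|right|case; lra].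
  rewrite (flat_closure fc _ nn k4P); last by apply: cl => /=; lra.
  by rewrite (flat_closure fc _ np k3P) //; apply: cl => /=; lra.
exists k; have : nbhs z (psi @` rect (- e) e (- e) e).
  by rewrite -psi0; apply: embedding_nbhs => //; apply: rect_nbhs; rewrite /rect /=; lra.
apply: filterS => _ [q [q1 q2] <-] nP.
have /not_orP[/eqP q10 /eqP q20] : ~ (q.1 = 0 \/ q.2 = 0) by move=> /Ppsi.
move: q10 q20; rewrite !neq_lt => /orP[q10|q10] /orP[q20|q20].
- by rewrite k4P ?k4k ?k3k //; exists q => //; split; lra.
- by rewrite k3P ?k3k //; exists q => //; split; lra.
- by rewrite k2P ?k2k //; exists q => //; split; lra.
- by rewrite kP //; exists q => //; split; lra.
Qed.

(** [O] minus [P] is usually disconnected, so the local value of the sum is extended over [P] as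
    [fc], which is locally constant on the connected set [O]. Density of the complement of [P] makes
    this value unique. *)
Lemma colouring_diff O g h : open O -> connected O -> colouring O g -> colouring O h ->
  exists c, forall w, O w -> ~ P w -> g w (+) h w = c.
Proof.
move=> oO cO gO hO; set f := fun w => g w (+) h w.
pose fc z := `[< flat f z true >].
have fcE z c : flat f z c -> fc z = c.
  move=> fz; rewrite /fc; case: asboolP => fz'.
    by have [w [fw fw'] Pw] := P_dense (filterI fz fz'); rewrite -fw // fw'.
  by case: c fz.
have [[v0 Ov0]|O0] := pselect (O !=set0); last first.
  by exists true => w Ow; exfalso; apply: O0; exists w.
exists (fc v0) => w Ow Pw.
have [c fcw] := flat_diff oO Ow gO hO.
rewrite (nbhs_singleton fcw Pw) -(fcE w c fcw).
apply: (connected_locally_constant cO) => // z Oz.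
have [c' fz] := flat_diff oO Oz gO hO.
apply: filterS (nbhs_interior fz) => v fv _.
by rewrite (fcE z c' fz); exact: fcE.
Qed.

(** * Gluing local colourings *)

Lemma colourableU O1 O2 : open O1 -> open O2 -> connected (O1 `&` O2) ->
  colourable O1 -> colourable O2 -> colourable (O1 `|` O2).
Proof.
move=> o1 o2 c12 [g1 g1P] [g2 g2P].
have [c gc] : exists c, forall w, (O1 `&` O2) w -> ~ P w -> g1 w (+) g2 w = c.
  by apply: colouring_diff; [exact: openI|by []|move=> w [/g1P]|move=> w [_ /g2P]].
exists (fun w => if `[< O1 w >] then g1 w else g2 w (+) c) => z [Oz|Oz].
  apply: good_at_eq (g1P z Oz).
  have : nbhs z O1 by apply: open_nbhs_nbhs.
  by apply: filterS => w Ow _; case: asboolP.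
apply: good_at_eq (good_at_addb c (g2P z Oz)).
have : nbhs z O2 by apply: open_nbhs_nbhs.
apply: filterS => w Ow Pw; case: asboolP => // O1w.
by rewrite -(gc w) // addbC -addbA addbb addbF.
Qed.

Lemma colourableS O O' : O' `<=` O -> colourable O -> colourable O'.
Proof. by move=> O'O [g gO]; exists g => z /O'O/gO. Qed.

(** In a chart where [P] is the zero set of [h], the sign of [h] is a colouring as soon as [h] takes
    both signs near each simple zero. *)
Lemma colourable_chart psi (h : pt -> R) z : open_embedding psi -> continuous h ->
  (forall q, P (psi q) <-> h q = 0 :> R) ->
  (forall q, h q = 0 -> ~ M (psi q) -> forall U, nbhs q U ->
    exists u v, [/\ U u, U v, h u < 0 & 0 < h v]) ->
  colouring (range psi) (fun w => `[< exists2 q, w = psi q & 0 < h q >]).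
Proof.
move=> epsi ch hP hU _ [q _ <-]; have [cpsi ipsi _] := epsi.
set g := fun w => _; have gpsi u : g (psi u) = (0 < h u).
  rewrite /g; case: asboolP => [[v /ipsi <- //]|nu]; apply/esym/negbTE/negP => hu.
  by apply: nu; exists u.
split=> [|/hP hq Mq U /cpsi Uq].
  rewrite hP => /eqP; rewrite neq_lt gpsi => /orP[hq|hq].
    have : nbhs q [set u | h u < 0] by apply: (ch q [set x | x < 0]); apply: open_nbhs_nbhs; split=> //; exact: open_lt.
    move=> /(embedding_nbhs epsi); apply: filterS => _ [u /= hu <-].
    by rewrite gpsi !ltNge !ltW.
  have : nbhs q [set u | 0 < h u] by apply: (ch q [set x | 0 < x]); apply: open_nbhs_nbhs; split=> //; exact: open_gt.
  move=> /(embedding_nbhs epsi); apply: filterS => _ [u /= hu <-].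
  by rewrite gpsi hu hq.
have [u [v [Uu Uv hu hv]]] := hU q hq Mq _ Uq.
exists (psi u), (psi v); split=> //.
- by rewrite hP => h0; rewrite h0 ltxx in hu.
- by rewrite hP => h0; rewrite h0 ltxx in hv.
- by rewrite !gpsi hv ltNge ltW.
Qed.

Lemma colourable_near z : exists O, [/\ open O, O z & colourable O].
Proof.
have rpsi psi : open_embedding psi -> open (range psi).
  by case=> _ _; apply; exact: openT.
have [Pz|Pz] := pselect (P z); last first.
  exists (~` P); split=> //; first exact: closed_openC.
  by exists xpredT => w Pw; split=> // _; exact: filterS filterT.
have [Mz|Mz] := pselect (M z).
  have [psi [epsi psi0 psiP]] := P_crossing Mz.
  exists (range psi); split; [exact: rpsi|by exists (0, 0)|eexists].
  (* The sign of the product of the coordinates alternates around the crossing. *)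
  apply: (@colourable_chart psi (fun q => q.1 * q.2) z epsi) => //.
  - move=> q; apply: cvgM; [exact: cvg_fst|exact: cvg_snd].
  - move=> q; rewrite -[P (psi q)]/((psi @^-1` P) q) psiP /=.
    split=> [[->|->]|/eqP]; rewrite ?mul0r ?mulr0 //.
    by rewrite mulf_eq0 => /orP[] /eqP; [left|right].
  move=> [x y] /= /eqP; rewrite mulf_eq0 => xy0 Mxy U /nbhs_rect[e e0 eU].
  have x0y0 : ~ (x = 0 /\ y = 0) by case=> x0 y0; apply: Mxy; rewrite x0 y0 psi0.
  have [x0|x0|x0] := ltgtP x 0.
  + have y0 : y = 0 by case/orP: xy0 => /eqP // x0'; rewrite x0' ltxx in x0.
    exists (x, e / 2), (x, - (e / 2)); split.
    * by apply: eU; rewrite /rect /= y0; lra.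
    * by apply: eU; rewrite /rect /= y0; lra.
    * by rewrite /=; nra.
    * by rewrite /=; nra.
  + have y0 : y = 0 by case/orP: xy0 => /eqP // x0'; rewrite x0' ltxx in x0.
    exists (x, - (e / 2)), (x, e / 2); split.
    * by apply: eU; rewrite /rect /= y0; lra.
    * by apply: eU; rewrite /rect /= y0; lra.
    * by rewrite /=; nra.
    * by rewrite /=; nra.
  + have [y0|y0|y0] := ltgtP y 0; last by case: x0y0.
    * exists (e / 2, y), (- (e / 2), y); split;
        [apply: eU; rewrite /rect /=|apply: eU; rewrite /rect /=|rewrite /=|rewrite /=]; by [lra|nra].
    * exists (- (e / 2), y), (e / 2, y); split;
        [apply: eU; rewrite /rect /=|apply: eU; rewrite /rect /=|rewrite /=|rewrite /=]; by [lra|nra].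
have [psi [epsi psi0 psiP]] := P_arc Pz Mz.
exists (range psi); split; [exact: rpsi|by exists (0, 0)|eexists].
apply: (@colourable_chart psi snd z epsi) => //.
- by move=> q; exact: cvg_snd.
- by move=> q; rewrite -[P (psi q)]/((psi @^-1` P) q) psiP.
move=> [x y] /= y0 _ U /nbhs_rect[e e0 eU].
exists (x, - (e / 2)), (x, e / 2); split;
  [apply: eU; rewrite /rect /=|apply: eU; rewrite /rect /=|rewrite /=|rewrite /=]; lra.
Qed.

(** A form of compactness of segments: [Q a b] is thought of as a property of the open interval from
    [a] to [b], inherited by smaller intervals, true locally and preserved by gluing overlapping
    intervals. *)
Lemma interval_induction (Q : R -> R -> Prop) :
  (forall a b a' b', a <= a' -> b' <= b -> Q a b -> Q a' b') ->
  (forall x, exists2 e, 0 < e & Q (x - e) (x + e)) ->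
  (forall a b a' b', a < a' -> a' < b -> b < b' -> Q a b -> Q a' b' -> Q a b') ->
  forall a b, Q a b.
Proof.
move=> Qs Ql Qg a b.
have [ba|ab] := leP b a.
  by have [e e0 Qe] := Ql a; apply: Qs Qe; lra.
(* The margin [e] makes consecutive intervals overlap. *)
pose S := [set t | a <= t <= b /\ exists2 e, 0 < e & Q (a - e) (t + e)].
have Sa : S a by split; [lra|exact: Ql].
have Sb : ubound S b by move=> t [/andP[]].
have Ssup : has_sup S by split; [exists a|exists b].
have sa : a <= sup S by apply: ub_le_sup => //; exists b.
have sb : sup S <= b by apply: ge_sup => //; exists a.
have [e e0 Qe] := Ql (sup S).
have [t [atb [e1 e10 Qt]] st] := sup_adherent e0 Ssup.
have ts : t <= sup S by apply: ub_le_sup; [exists b|split=> //; exists e1].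
have Qse : Q (a - e1) (sup S + e).
  have [le|lt] := leP (sup S - e) (a - e1); first by apply: Qs Qe; lra.
  have [le2|lt2] := leP (sup S + e) (t + e1); first by apply: Qs Qt; lra.
  by apply: Qg Qt Qe; lra.
have [lt|] := ltP (sup S) b; last by move=> bs; apply: Qs Qse; lra.
(* If the supremum were below [b], this larger point would still belong to [S]. *)
pose t' := if sup S + e / 2 < b then sup S + e / 2 else b.
have [t'1 [t'2 t'3]] : sup S < t' /\ t' <= b /\ t' <= sup S + e / 2 by rewrite /t'; case: (ltP (sup S + e / 2) b) => ?; do ?split; lra.
pose e2 := if e1 < e / 2 then e1 else e / 2.
have [e20 [e21 e22]] : 0 < e2 /\ e2 <= e1 /\ e2 <= e / 2 by rewrite /e2; case: (ltP e1 (e / 2)) => ?; do ?split; lra.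
have : S t' by split; [lra|exists e2; [lra|apply: Qs Qse; lra]].
move=> St'; have : t' <= sup S by apply: ub_le_sup => //; exists b.
lra.
Qed.

Lemma rect_setI (a b c d a' b' c' d' : R) : rect a b c d `&` rect a' b' c' d' =
  rect (Num.max a a') (Num.min b b') (Num.max c c') (Num.min d d').
Proof.
apply/seteqP; split=> q; rewrite /rect /= !gt_max !lt_min.
  by move=> [[/andP[-> ->] /andP[-> ->]] [/andP[-> ->] /andP[-> ->]]].
by move=> [/andP[/andP[-> ->] /andP[-> ->]] /andP[/andP[-> ->] /andP[-> ->]]].
Qed.

Lemma colourable_rectU (a b c d a' b' c' d' : R) :
  colourable (rect a b c d) -> colourable (rect a' b' c' d') ->
  colourable (rect a b c d `|` rect a' b' c' d').
Proof.
by apply: colourableU; [exact: rect_open|exact: rect_open|rewrite rect_setI; exact: rect_connected].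
Qed.

(** The half-width is part of the property under induction on the height; gluing two pieces keeps
    the smaller one. *)
Lemma colourable_strip x c d : exists2 e : R, 0 < e & colourable (rect (x - e) (x + e) c d).
Proof.
move: c d; apply: interval_induction => [c d c' d' cc' dd' [e e0 ce]|y|c d c' d' cc' c'd dd' [e e0 ce] [e' e'0 ce']].
- by exists e => //; apply: colourableS ce => q [q1 q2]; split=> //; lra.
- have [W [oW Wxy cW]] := colourable_near (x, y).
  have [e e0 eW] := nbhs_rect (open_nbhs_nbhs (conj oW Wxy)).
  by exists e => //; exists e => //; apply: colourableS cW.
- pose e2 := if e < e' then e else e'.
  have [e20 [e21 e22]] : 0 < e2 /\ e2 <= e /\ e2 <= e' by rewrite /e2; case: (ltP e e') => ?; do ?split; lra.
  exists e2; first by lra.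
  apply: colourableS (colourable_rectU ce ce') => q [q1 q2].
  by have [q2d|dq2] := ltP q.2 d; [left|right]; split; lra.
Qed.

Lemma colourable_rect (a b c d : R) : colourable (rect a b c d).
Proof.
move: a b; apply: interval_induction => [a b a' b' aa' bb' cab|x|a b a' b' aa' a'b bb' c1 c2].
- by apply: colourableS cab => q [q1 q2]; split=> //; lra.
- exact: colourable_strip.
- apply: colourableS (colourable_rectU c1 c2) => q [q1 q2].
  by have [q1b|bq1] := ltP q.1 b; [left|right]; split; lra.
Qed.

(** Colourings of growing squares agree off [P] after being normalised at a common base point [w0];
    each point is coloured by a square that contains it. *)
Lemma exists_colouring : exists g, forall z, good_at g z.
Proof.
pose B (N : nat) := rect (- N%:R : R) N%:R (- N%:R) N%:R.
have /choice[g gP] N : exists g, colouring (B N) g by exact: colourable_rect.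
have [w0 Bw0 Pw0] : exists2 w, B 1 w & ~ P w.
  by apply: (P_dense (z := (0, 0))); apply: rect_nbhs; rewrite /rect /=; lra.
have B1 N : (0 < N)%N -> B N w0.
  rewrite -(ler_nat R) => N1; move: Bw0; rewrite /B /rect /=; lra.
have g_eq N N' w : (0 < N <= N')%N -> B N w -> ~ P w ->
    g N w (+) g N w0 = g N' w (+) g N' w0.
  move=> /andP[N0 NN'] Bw Pw.
  have [c gc] : exists c, forall w, B N w -> ~ P w -> g N w (+) g N' w = c.
    apply: colouring_diff; [exact: rect_open|exact: rect_connected|exact: gP|].
    move=> v [v1 v2]; apply: gP; move: NN'; rewrite -(ler_nat R) /B /rect /=; lra.
  have := gc w Bw Pw; rewrite -(gc w0 (B1 N N0) Pw0).
  by case: (g N w); case: (g N w0); case: (g N' w); case: (g N' w0).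
pose rk (w : pt) := (Num.bound (`|w.1| + `|w.2|)).+1.
have rkP w : B (rk w) w.
  have := archi_boundP (addr_ge0 (normr_ge0 w.1) (normr_ge0 w.2)).
  have : (Num.bound (`|w.1| + `|w.2|))%:R <= (rk w)%:R :> R by rewrite ler_nat.
  have := ler_norm w.1; have := ler_norm (- w.1).
  have := ler_norm w.2; have := ler_norm (- w.2).
  rewrite !normrN; rewrite /B /rect /=; lra.
exists (fun w => g (rk w) w (+) g (rk w) w0) => z.
apply: good_at_eq (good_at_addb (g (rk z) w0) (gP _ z (rkP z))).
have : nbhs z (B (rk z)) by exact/rect_nbhs/rkP.
apply: filterS => w Bw Pw.
have [le|/ltnW le] := leqP (rk z) (rk w); first by rewrite (g_eq (rk z) (rk w)).
exact: g_eq.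
Qed.

End Colouring.

(** * The projection of a knot *)

Section KnotProjection.
Variables (R : realType) (K : knot R).
Local Notation pt := (R * R)%type.
Implicit Types (s t u v w : R) (k : int) (D : set pt).

Lemma knot_shift u k : K (u + k%:~R) = K u.
Proof. by apply/knot_period; exists k. Qed.

Lemma knot_plane_continuous : continuous (fun u => (K u).1).
Proof. move=> u; apply: (@continuous_comp _ _ _ (knot_fun K) fst); last exact: cvg_fst.
exact: knot_continuous. Qed.

Lemma projectionP z : projection K z <-> exists u, (K u).1 = z.
Proof.
by split=> [[_ [u _ <-] <-]|[u <-]]; [exists u|exists (K u) => //; exists u].
Qed.

Lemma knot_period_itv a u : exists k, a <= u + k%:~R < a + 1.
Proof.
exists (- Num.floor (u - a)); rewrite rmorphN /=.
have := floor_itv (u - a); rewrite intrD; lra.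
Qed.

Lemma knot_arc_closed a b : closed [set (K u).1 | u in `[a, b]].
Proof.
apply: compact_closed; first exact: plane_hausdorff.
apply: continuous_compact; last exact: segment_compact.
exact/continuous_subspaceT/knot_plane_continuous.
Qed.

Lemma projection_closed : closed (projection K).
Proof.
suff -> : projection K = [set (K u).1 | u in `[0, 1]] by exact: knot_arc_closed.
apply/seteqP; split=> [z /projectionP[u <-]|_ [u _ <-]]; last by apply/projectionP; exists u.
have [k uk] := knot_period_itv 0 u.
by exists (u + k%:~R); rewrite ?knot_shift //= in_itv /=; lra.
Qed.

Definition multiple u : Prop := multiple_point K (K u).1.

Definition clear u v : Prop :=
  forall w, (u < w < v) \/ (v < w < u) -> ~ multiple w.

Lemma multiple_shift u k : multiple (u + k%:~R) <-> multiple u.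
Proof. by rewrite /multiple knot_shift. Qed.

Lemma clear_sym u v : clear u v -> clear v u.
Proof. by move=> c w [?|?]; apply: c; [right|left]. Qed.

Lemma clear_shift u v k : clear u v -> clear (u + k%:~R) (v + k%:~R).
Proof.
move=> c w wP mw; apply: (c (w - k%:~R)).
  by case: wP => wP; [left|right]; lra.
by apply/(multiple_shift _ k); rewrite subrK.
Qed.

Lemma simple_param u v : ~ multiple u -> (K u).1 = (K v).1 -> exists k, u = v + k%:~R.
Proof.
move=> nu e; apply/(knot_period K); apply: contrapT => nK.
by apply: nu; exists (K u), (K v).
Qed.

Hypothesis K_regular : regular_projection K.

Lemma multiple_finite : finite_set (multiple_point K).
Proof. by case: K_regular. Qed.

Lemma regular_arc z : projection K z -> ~ multiple_point K z -> exists psi,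
  [/\ open_embedding psi, psi (0, 0) = z & psi @^-1` projection K = [set q | q.2 = 0]].
Proof. by case: K_regular => _ _; apply. Qed.

Lemma regular_crossing z : multiple_point K z -> exists psi,
  [/\ open_embedding psi, psi (0, 0) = z &
    psi @^-1` projection K = [set q | q.1 = 0 \/ q.2 = 0]].
Proof.
by case: K_regular => _ + _ => /[apply] -[s [t [psi []]]] *; exists psi.
Qed.

Lemma multiple_closed : closed multiple.
Proof.
have -> : multiple = (fun u => (K u).1) @^-1` multiple_point K by [].
apply: closed_comp; first by move=> u _; exact: knot_plane_continuous.
have [+ _] := @accessible_finite_set_closed pt.
by move=> /(_ (hausdorff_accessible (@plane_hausdorff R))); apply; exact: multiple_finite.
Qed.

(** ** Domains adjacent to a point of the projection *)

Definition adjacent_domain (z : pt) D : Prop := domain K D /\ closure D z.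

Lemma domain_projection D z : domain K D -> D z -> ~ projection K z.
Proof. by move=> [p _ <-] /connected_component_sub. Qed.

Lemma domain_eq D D' z : domain K D -> domain K D' -> D z -> D' z -> D = D'.
Proof.
move=> [p _ <-] [p' _ <-] /same_connected_component -> .
by move=> /same_connected_component ->.
Qed.

Lemma domain_connected D : domain K D -> connected D.
Proof. by move=> [p _ <-]; exact: component_connected. Qed.

Lemma domain_nonempty D : domain K D -> D !=set0.
Proof. by move=> [p Pp <-]; exists p; exact: connected_component_refl. Qed.

Lemma connected_domain S : connected S -> S !=set0 -> S `<=` ~` projection K ->
  exists2 D, domain K D & S `<=` D.
Proof.
move=> cS [z Sz] SP; exists (connected_component (~` projection K) z).
  by exists z => //; exact: SP.
exact: connected_component_max.
Qed.

(** A domain adherent to [z] meets [V] off the projection, hence meets one of the two sides and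
    equals the domain of that side. *)
Lemma two_sided_adjacent V S T DS DT z : two_sided (projection K) V S T ->
  domain K DS -> domain K DT -> S `<=` DS -> T `<=` DT -> V z -> projection K z ->
  forall D, adjacent_domain z D <-> D = DS \/ D = DT.
Proof.
move=> [oV _ _ VST clS clT] dS dT SD TD Vz Pz D; split=> [[dD clD]|[->|->]].
- have [w [Dw Vw]] := clD V (open_nbhs_nbhs (conj oV Vz)).
  have : (V `\` projection K) w by split=> //; exact: domain_projection dD Dw.
  by rewrite VST => -[/SD|/TD] DTw; [left|right]; exact: domain_eq Dw DTw.
- by split=> //; apply: closureS SD _ _; exact: clS.
- by split=> //; apply: closureS TD _ _; exact: clT.
Qed.

Lemma adjacent_near z : projection K z -> ~ multiple_point K z ->
  \forall w \near z, projection K w -> adjacent_domain w = adjacent_domain z.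
Proof.
move=> Pz Mz.
have [V [S [T [_ Vz ts]]]] := arc_two_sided regular_arc Pz Mz filterT.
have VP U : U `<=` S `|` T -> U `<=` ~` projection K.
  by move=> UST w /UST; rewrite -(side_cover ts) => -[].
have ne U : closure U z -> U !=set0.
  by move=> /(_ _ filterT)[w [Uw _]]; exists w.
have [DS dS SD] : exists2 D, domain K D & S `<=` D.
  apply: connected_domain; [by case: ts|exact/ne/(side_closure1 ts)|].
  by apply: VP; exact: subsetUl.
have [DT dT TD] : exists2 D, domain K D & T `<=` D.
  apply: connected_domain; [by case: ts|exact/ne/(side_closure2 ts)|].
  by apply: VP; exact: subsetUr.
have : nbhs z V by apply: open_nbhs_nbhs; split=> //; case: ts.
apply: filterS => w Vw Pw; apply/funext => D; apply/propext.
have := two_sided_adjacent ts dS dT SD TD Vz Pz D.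
have := two_sided_adjacent ts dS dT SD TD Vw Pw D.
tauto.
Qed.

Lemma adjacent_connected (A : set pt) (z z' : pt) : connected A ->
  A `<=` projection K `\` multiple_point K -> A z -> A z' -> adjacent_domain z = adjacent_domain z'.
Proof.
move=> cA AP Az Az'; apply: (connected_locally_constant cA) => // p /AP[Pp Mp].
by apply: filterS (adjacent_near Pp Mp) => p' Pp' /AP[/Pp'].
Qed.

(** The set of adjacent domains is locally constant along simple points, and the image of the
    parameter interval is connected. *)
Lemma adjacent_clear u v : ~ multiple u -> ~ multiple v -> clear u v ->
  adjacent_domain (K u).1 = adjacent_domain (K v).1.
Proof.
wlog uv : u v / u <= v.
  move=> wl nu nv c; have [uv|/ltW vu] := leP u v; first exact: wl.
  by apply/esym/wl => //; exact: clear_sym.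
move=> nu nv c; apply: (@adjacent_connected ((fun w => (K w).1) @` `[u, v])).
- apply: connected_continuous_connected; first exact: segment_connected.
  exact/continuous_subspaceT/knot_plane_continuous.
- move=> _ [w /= + <-]; rewrite in_itv /= => /andP[uw wv].
  split; first by apply/projectionP; exists w.
  have [<-//|nuw] := eqVneq u w; have [->//|nwv] := eqVneq w v.
  by apply: (c w); left; rewrite !lt_neqAle nuw uw nwv wv.
- by exists u => //=; rewrite in_itv /= lexx.
- by exists v => //=; rewrite in_itv /= lexx andbT.
Qed.

(** ** The ends of an edge *)

Lemma closed_next (A : set R) u v : closed A -> A v -> u <= v -> ~ A u ->
  exists t, [/\ A t, u < t <= v & forall w, u < w < t -> ~ A w].
Proof.
move=> cA Av uv Au; pose B := [set t | A t /\ u <= t].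
have Binf : has_inf B by split; [exists v|exists u => t []].
have Blb t : B t -> inf B <= t by apply: ge_inf; case: Binf.
have uB : u <= inf B by apply: lb_le_inf; [exists v|move=> t []].
have AB : A (inf B).
  apply: cA => U /nbhs_ballP[e /= e0 eU].
  have [t [At ut] te] := inf_adherent e0 Binf.
  exists t; split=> //; apply: eU; rewrite -ball_normE /= ltr_norml.
  have := Blb t (conj At ut); lra.
exists (inf B); split=> //.
  by rewrite lt_neqAle uB Blb // !andbT; apply/eqP => uE; rewrite -uE in AB.
by move=> w /andP[uw wB] Aw; have := Blb w (conj Aw (ltW uw)); rewrite leNgt wB.
Qed.

Lemma closed_prev (A : set R) u v : closed A -> A v -> v <= u -> ~ A u ->
  exists t, [/\ A t, v <= t < u & forall w, t < w < u -> ~ A w].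
Proof.
move=> cA Av vu Au.
have [||||t [At tb tP]] := @closed_next (-%R @^-1` A) (- u) (- v).
- by apply: closed_comp => // w _; exact: opp_continuous.
- by rewrite /preimage /= opprK.
- by rewrite lerN2.
- by rewrite /preimage /= opprK.
exists (- t); split=> //; first lra.
by move=> w wt Aw; apply: (tP (- w)); [lra|rewrite /preimage /= opprK].
Qed.

Lemma next_multiple s u : multiple s -> ~ multiple u ->
  exists t, [/\ multiple t, u < t & forall w, u < w < t -> ~ multiple w].
Proof.
move=> ms mu; have [k uk] := knot_period_itv u s.
have [|t [mt /andP[ut _] tP]] := closed_next multiple_closed _ (andP uk).1 mu.
  exact/multiple_shift.
by exists t.
Qed.

Lemma prev_multiple s u : multiple s -> ~ multiple u ->
  exists t, [/\ multiple t, t < u & forall w, t < w < u -> ~ multiple w].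
Proof.
move=> ms mu; have [k uk] := knot_period_itv (u - 1) s.
have [||t [mt /andP[_ ut] tP]] := closed_prev (u := u) (v := s + k%:~R) multiple_closed _ _ mu.
- exact/multiple_shift.
- by lra.
by exists t.
Qed.

Lemma multiple_lt u v : multiple u -> ~ multiple v -> u <= v -> u < v.
Proof. by move=> mu mv; rewrite le_eqVlt => /predU1P[e|//]; rewrite e in mu. Qed.

Lemma multiple_gt u v : multiple u -> ~ multiple v -> v <= u -> v < u.
Proof. by move=> mu mv; rewrite le_eqVlt => /predU1P[e|//]; rewrite e in mv. Qed.

(** Let [a] and [b] be the multiple parameters next to [u]. The images of [a, b] and [b, a + 1] are
    closed, cover the projection and share no simple point; so the edge through [u], being
    connected, lies in the first. *)
Lemma same_edge s u v : multiple s -> ~ multiple u -> ~ multiple v ->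
  connected_component (projection K `\` multiple_point K) (K u).1 (K v).1 ->
  exists k, clear u (v + k%:~R).
Proof.
move=> ms mu mv; have [a [ma au aP]] := prev_multiple ms mu.
have [b [mb ub bP]] := next_multiple ms mu.
have ab w : a < w < b -> ~ multiple w.
  move=> /andP[aw wb]; have [wu|uw|->//] := ltgtP w u; first by apply: aP; rewrite aw.
  by apply: bP; rewrite uw.
have ba1 : b <= a + 1.
  rewrite leNgt; apply/negP => a1b.
  by apply: (ab (a + 1)); [lra|exact/(multiple_shift _ 1)].
pose F c d := [set (K w).1 | w in `[c, d]].
set C := connected_component _ _ => Cv.
have CP : C `<=` projection K `\` multiple_point K by exact: connected_component_sub.
(* Two parameters of a common simple point would differ by an integer strictly between -1 and 0. *)
have disj z : C z -> F a b z -> F b (a + 1) z -> False.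
  move=> /CP[_ Mz] [w1 /= +] w1z [w2 /= +] w2z; rewrite !in_itv /= => w1P w2P.
  have m1 : ~ multiple w1 by rewrite /multiple w1z.
  have m2 : ~ multiple w2 by rewrite /multiple w2z.
  have [k w12] := simple_param m1 (etrans w1z (esym w2z)).
  have ma1 : multiple (a + 1) by exact/(multiple_shift _ 1).
  move: w1P w2P => /andP[aw1 w1b] /andP[bw2 w2a].
  have {}aw1 := multiple_lt ma m1 aw1; have {}w1b := multiple_gt mb m1 w1b.
  have {}bw2 := multiple_lt mb m2 bw2; have {}w2a := multiple_gt ma1 m2 w2a.
  have : ((-1 : R) < k%:~R) && (k%:~R < (0 : R)) by lra.
  by rewrite -[-1]/((-1)%:~R) -[0]/(0%:~R) !ltr_int; case: (k) => [] [] // [].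
have cover z : C z -> F a b z \/ F b (a + 1) z.
  move=> /CP[/projectionP[w <-] _]; have [k wk] := knot_period_itv a w.
  have [wb|bw] := leP (w + k%:~R) b; [left|right];
    by exists (w + k%:~R); rewrite ?knot_shift //= in_itv /=; lra.
have CF : C `&` F a b = C.
  apply: (component_connected (A := projection K `\` multiple_point K) (x := (K u).1)).
  - exists (K u).1; split; last by exists u => //=; rewrite in_itv /=; lra.
    by apply: connected_component_refl; split=> //; apply/projectionP; exists u.
  - exists (~` F b (a + 1)); first exact/closed_openC/knot_arc_closed.
    apply/seteqP; split=> z [Cz Fz]; split=> //; first by move/(disj z Cz Fz).
    by case: (cover z Cz).
  - by exists (F a b) => //; exact: knot_arc_closed.
have [_ [w /= + wv]] : (C `&` F a b) (K v).1 by rewrite CF.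
rewrite in_itv /= => wP; have mw : ~ multiple w by rewrite /multiple wv.
have [k ewk] := simple_param mw wv; exists k; rewrite -ewk => y yP.
move: wP => /andP[/(multiple_lt ma mw) aw /(multiple_gt mb mw) wb].
by apply: ab; case: yP => yP; lra.
Qed.

Hypothesis K_alternating : alternating_projection K.

(** The clear intervals chain up from [s] to [s'], so no multiple parameter lies strictly between
    these two. If they were distinct they would be consecutive, and alternation would contradict one
    of the last two hypotheses. *)
Lemma clear_ends s s' u v : multiple s -> multiple s' -> ~ multiple u -> ~ multiple v ->
  clear s u -> clear u v -> clear v s' ->
  ~ (over_at K s <-> under_at K s') -> ~ (over_at K s' <-> under_at K s) -> s = s'.
Proof.
move=> ms ms' mu mv su uv vs' n n'.
have nb p q w : clear p q -> multiple w -> p < w -> q <= w.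
  by move=> c mw pw; rewrite leNgt; apply/negP => wq; apply: (c w) => //; left; rewrite pw.
have [lt|lt|//] := ltgtP s s'.
  case: n; apply: K_alternating => // w sw ws' mw.
  have /(nb _ _ _ vs' mw) : v < w.
    exact/(multiple_gt mw mv)/(nb _ _ _ uv mw)/(multiple_gt mw mu)/(nb _ _ _ su mw).
  by rewrite leNgt ws'.
case: n'; apply: K_alternating => // w sw ws' mw.
have /(nb _ _ _ (clear_sym su) mw) : u < w.
  exact/(multiple_gt mw mu)/(nb _ _ _ (clear_sym uv) mw)/(multiple_gt mw mv)/(nb _ _ _ (clear_sym vs') mw).
by rewrite leNgt ws'.
Qed.

End KnotProjection.

(** * Charts at the crossings *)

Section AxisCharts.
Variables (R : realType) (K : knot R).
Local Notation pt := (R * R)%type.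
Implicit Types (s t u v w x y : R) (D : set pt) (psi : pt -> pt).

(* The common part of the overcrossing and the undercrossing strand: the
   horizontal axis of the chart is the strand of parameter s. *)
Record axis_chart s t psi : Prop := {
  axis_embedding : open_embedding psi;
  axis_center : psi (0, 0) = (K s).1;
  axis_image : psi @^-1` projection K = [set q | q.1 = 0 \/ q.2 = 0];
  axis_other : (K t).1 = (K s).1;
  axis_neq : K s <> K t;
  axis_double : forall u, (K u).1 = (K s).1 -> K u = K s \/ K u = K t;
  axis_strand : \forall u \near s, exists x, (K u).1 = psi (x, 0);
  axis_other_strand : \forall u \near t, exists y, (K u).1 = psi (0, y) }.

Definition flip (q : pt) : pt := (q.2, q.1).

Lemma open_embedding_flip psi : open_embedding psi -> open_embedding (psi \o flip).
Proof.
case=> cpsi ipsi opsi; split.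
- by move=> q; apply: continuous_comp; [exact: swap_continuous|exact: cpsi].
- by move=> [x y] [x' y'] /ipsi[-> ->].
- move=> U oU; rewrite -image_comp; apply: opsi.
  have -> : flip @` U = flip @^-1` U.
    by apply/seteqP; split=> [_ [[x y] Uxy <-]|[x y] Uxy] //; exists (y, x).
  by apply: open_comp => // q _; exact: swap_continuous.
Qed.

Lemma crossing_chart_over p s t psi : crossing_chart K p s t psi -> axis_chart s t psi.
Proof.
case=> epsi psi0 psiP Ks Kt h dbl os ot; split=> //; rewrite ?Ks ?Kt //.
by move=> e; rewrite e ltxx in h.
Qed.

(** Exchanging the coordinates makes the undercrossing strand horizontal, so each result on axis
    charts serves both strands. *)
Lemma crossing_chart_under p s t psi : crossing_chart K p s t psi ->
  axis_chart t s (psi \o flip).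
Proof.
case=> epsi psi0 psiP Ks Kt h dbl os ot; split=> //; rewrite ?Ks ?Kt //.
- exact: open_embedding_flip.
- have -> : (psi \o flip) @^-1` projection K = flip @^-1` (psi @^-1` projection K) by [].
  by rewrite psiP; apply/seteqP; split=> -[x y] /= [?|?]; [right|left|right|left].
- by move=> e; rewrite e ltxx in h.
- by move=> u /dbl[]; [right|left].
Qed.

Hypothesis K_regular : regular_projection K.

Section Chart.
Variables (s t : R) (psi : pt -> pt).
Hypothesis chart : axis_chart s t psi.

Lemma axis_projection q : projection K (psi q) <-> q.1 = 0 \/ q.2 = 0.
Proof. by rewrite -[projection K _]/((psi @^-1` projection K) q) (axis_image chart). Qed.

Lemma axis_inj : injective psi.
Proof. by case: (axis_embedding chart). Qed.

Lemma axis_multiple : multiple K s.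
Proof.
have [_ _ _ st n _ _ _] := chart.
by exists (K s), (K t).
Qed.

Lemma axis_isolated : exists2 e, 0 < e & forall u, `|u - s| < e -> multiple K u -> u = s.
Proof.
have h1 : \forall u \near s, multiple_point K (K u).1 -> (K u).1 = (K s).1.
  have cs := @knot_plane_continuous R K s.
  exact: (cs _ (M_isolated (multiple_finite K_regular) (K s).1)).
have h2 : \forall u \near s, K u <> K t.
  have o : open (~` [set K t]).
    by apply: closed_openC; apply: accessible_closed_set1; apply: hausdorff_accessible; exact: norm_hausdorff.
  apply: (@knot_continuous R K s (~` [set K t])).
  by apply: open_nbhs_nbhs; split=> //; exact: axis_neq chart.
have /nbhs_ballP[e /= e0 eP] : nbhs s [set u |
    (multiple_point K (K u).1 -> (K u).1 = (K s).1) /\ K u <> K t].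
  exact: filterI h1 h2.
(* The bound 1 excludes the other integer translates of [s]. *)
exists (Num.min e 1); first by rewrite lt_min e0 ltr01.
move=> u; rewrite lt_min distrC => /andP[ue u1] mu.
have [/(_ mu) us nt] := eP u ue.
have [/knot_period[k uk]|//] := axis_double chart us.
move: u1; rewrite uk opprD addNKr normrN -intr_norm -[1]/(1%:~R) ltr_int.
by case: (k) => [[|k']|k'] // _; rewrite addr0.
Qed.

(** The parameters in [0, 1] at distance at least [e] from all translates of [s] and [t] form a
    compact set, whose image avoids the crossing and hence a neighbourhood of it. *)
Lemma axis_param (e : R) : 0 < e -> exists2 r : R, 0 < r & forall q, rect (- r) r (- r) r q ->
  projection K (psi q) -> exists2 u, (K u).1 = psi q & `|u - s| < e \/ `|u - t| < e.
Proof.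
move=> e0.
pose C := [set` `[(0 : R), 1]] `&` \bigcap_(k in [set: int])
  ([set u | e <= `|u - (s + k%:~R)|] `&` [set u | e <= `|u - (t + k%:~R)|]).
have far (a : R) : closed [set u : R | e <= `|u - a|].
  have -> : [set u : R | e <= `|u - a|] = (fun u => `|u - a|) @^-1` [set y | e <= y] by [].
  apply: closed_comp; last exact: closed_ge.
  move=> u _; apply: cvg_norm; apply: cvgB; [exact: cvg_id|exact: cvg_cst].
have cC : compact C.
  apply: compact_closedI; first exact: segment_compact.
  by apply: closed_bigI => k _; apply: closedI; exact: far.
have cD : closed [set (K u).1 | u in C].
  apply: compact_closed; first exact: plane_hausdorff.
  apply: continuous_compact => //.
  exact/continuous_subspaceT/knot_plane_continuous.
have Dp : nbhs (psi (0, 0)) (~` [set (K u).1 | u in C]).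
  rewrite (axis_center chart); apply: open_nbhs_nbhs; split; first exact: closed_openC.
  move=> [u [_ uC] us]; case: (axis_double chart us) => /knot_period[k uk];
    have [] := uC k I; rewrite /= uk subrr normr0 => h1 h2;
    by [rewrite leNgt e0 in h1|rewrite leNgt e0 in h2].
have [r r0 rP] := embedding_rect (axis_embedding chart) Dp.
exists r => // q rq /projectionP[u0 u0q].
have [k uk] := knot_period_itv 0 u0.
have nC : ~ C (u0 + k%:~R).
  move=> Cu; apply: (rP (psi q)); first by exists q.
  by exists (u0 + k%:~R) => //; rewrite knot_shift.
have [l ul] : exists l : int, `|u0 + k%:~R - (s + l%:~R)| < e \/ `|u0 + k%:~R - (t + l%:~R)| < e.
  apply: contrapT => nl; apply: nC; split; first by rewrite /= in_itv /=; lra.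
  move=> l _; split; rewrite /= leNgt; apply/negP => h; apply: nl; exists l; [by left|by right].
exists (u0 + (k - l)%:~R); first by rewrite knot_shift.
have shift (a : R) : u0 + (k - l)%:~R - a = u0 + k%:~R - (a + l%:~R) by rewrite rmorphB /=; lra.
by rewrite !shift.
Qed.

(** The chart puts the strand near [s] on the horizontal axis without saying that it reaches both
    halves. Each half lies on the projection, and its points near the centre must come from
    parameters near [s]. The sign of [e] selects the half. *)
Lemma axis_half (e : R) : e != 0 -> exists x u,
  [/\ 0 < x, (K u).1 = psi (e * x, 0), ~ multiple K u & clear K s u].
Proof.
move=> en0; have [e1 e10 iso] := axis_isolated.
have /nbhs_ballP[e2 /= e20 e2P] := axis_other_strand chart.
have e30 : 0 < Num.min e1 e2 by rewrite lt_min e10.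
have [r r0 rP] := axis_param e30.
(* With this choice the point (e x, 0) is at distance r / 2 from the centre of the chart. *)
pose x := r / 2 / `|e|.
have nx : `|e| * x = r / 2 by rewrite /x mulrC divfK // normr_eq0.
have x0 : 0 < x by rewrite divr_gt0 ?normr_gt0 // divr_gt0.
have ex0 : e * x != 0 by rewrite mulf_neq0 // gt_eqF.
have rex : rect (- r) r (- r) r (e * x, 0).
  have : `|e * x| = r / 2 by rewrite normrM (gtr0_norm x0).
  move=> nex; have := ler_norm (e * x); have := ler_norm (- (e * x)).
  rewrite normrN nex /rect /=; lra.
have [|u ux [us|ut]] := rP _ rex; first by apply/axis_projection; right.
- move: us; rewrite lt_min => /andP[us _].
  have nms w : `|w - s| < e1 -> w <> s -> ~ multiple K w by move=> ws ns /(iso w ws).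
  exists x, u; split=> //.
    apply: nms => // es; move: ux; rewrite es -(axis_center chart) => /axis_inj[e0].
    by rewrite -e0 eqxx in ex0.
  move=> w ws; apply: nms; last by move=> e'; rewrite e' !ltxx ?andbF in ws; case: ws.
  by move: us; rewrite !ltr_norml; case: ws; lra.
(* A parameter near [t] would put the point on the vertical axis. *)
- move: ut; rewrite lt_min distrC => /andP[_ ut].
  have [y uy] := e2P u ut; move: ux; rewrite uy => /axis_inj[e0 _].
  by rewrite -e0 eqxx in ex0.
Qed.

Lemma chart_sides x D1 D2 : x != 0 ->
  (forall q, 0 < x * q.1 -> 0 < q.2 -> D1 (psi q)) ->
  (forall q, 0 < x * q.1 -> q.2 < 0 -> D2 (psi q)) ->
  exists V S T, [/\ two_sided (projection K) V S T, V (psi (x, 0)), S `<=` D1 & T `<=` D2].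
Proof.
move=> xn0 D1P D2P; pose h := `|x| / 2.
have h0 : 0 < h by rewrite divr_gt0 ?normr_gt0.
have hx y : x - h < y < x + h -> 0 < x * y.
  move=> yP; move: xn0; rewrite neq_lt => /orP[x0|x0].
    have hE : h = - x / 2 by rewrite /h ltr0_norm.
    by rewrite nmulr_rgt0 //; lra.
  have hE : h = x / 2 by rewrite /h gtr0_norm.
  by rewrite pmulr_rgt0 //; lra.
exists (psi @` rect (x - h) (x + h) (-1) 1), (psi @` rect (x - h) (x + h) 0 1),
  (psi @` rect (x - h) (x + h) (-1) 0); split.
- apply: chart_two_sided; [exact: axis_embedding chart|lra|lra|].
  move=> q [/hx q1 _]; rewrite axis_projection; split=> [[q0|//]|]; last by right.
  by rewrite q0 mulr0 ltxx in q1.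
- by exists (x, 0) => //; rewrite /rect /=; lra.
- by move=> _ [q [/hx q1 /andP[q2 _]] <-]; exact: D1P.
- by move=> _ [q [/hx q1 /andP[_ q2]] <-]; exact: D2P.
Qed.

Variables D1 D2 D3 D4 : set pt.
Hypothesis (D1_domain : domain K D1) (D2_domain : domain K D2)
  (D3_domain : domain K D3) (D4_domain : domain K D4).
Hypothesis quadrant1 : psi @` [set q | 0 < q.1 /\ 0 < q.2] `<=` D1.
Hypothesis quadrant2 : psi @` [set q | 0 < q.1 /\ q.2 < 0] `<=` D2.
Hypothesis quadrant3 : psi @` [set q | q.1 < 0 /\ q.2 < 0] `<=` D3.
Hypothesis quadrant4 : psi @` [set q | q.1 < 0 /\ 0 < q.2] `<=` D4.

Lemma axis_sides_right x : 0 < x -> exists V S T,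
  [/\ two_sided (projection K) V S T, V (psi (x, 0)), S `<=` D1 & T `<=` D2].
Proof.
move=> x0; apply: chart_sides; first by rewrite gt_eqF.
  by move=> q; rewrite pmulr_rgt0 // => q1 q2; apply: quadrant1; exists q.
by move=> q; rewrite pmulr_rgt0 // => q1 q2; apply: quadrant2; exists q.
Qed.

Lemma axis_sides_left x : x < 0 -> exists V S T,
  [/\ two_sided (projection K) V S T, V (psi (x, 0)), S `<=` D4 & T `<=` D3].
Proof.
move=> x0; apply: chart_sides; first by rewrite lt_eqF.
  by move=> q; rewrite nmulr_rgt0 // => q1 q2; apply: quadrant4; exists q.
by move=> q; rewrite nmulr_rgt0 // => q1 q2; apply: quadrant3; exists q.
Qed.

Lemma axis_adjacent_right x : 0 < x ->
  forall D, adjacent_domain K (psi (x, 0)) D <-> D = D1 \/ D = D2.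
Proof.
move=> /axis_sides_right[V [S [T [ts Vx SD TD]]]].
apply: (two_sided_adjacent ts) => //; apply/axis_projection; by right.
Qed.

Lemma axis_adjacent_left x : x < 0 ->
  forall D, adjacent_domain K (psi (x, 0)) D <-> D = D4 \/ D = D3.
Proof.
move=> /axis_sides_left[V [S [T [ts Vx SD TD]]]].
apply: (two_sided_adjacent ts) => //; apply/axis_projection; by right.
Qed.

Lemma axis_edge_right : exists u, [/\ ~ multiple K u, clear K s u &
  forall D, adjacent_domain K (K u).1 D <-> D = D1 \/ D = D2].
Proof.
have [x [u [x0 ux mu su]]] := axis_half (oner_neq0 R).
by exists u; split=> // D; rewrite ux mul1r; exact: axis_adjacent_right.
Qed.

Lemma axis_edge_left : exists u, [/\ ~ multiple K u, clear K s u &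
  forall D, adjacent_domain K (K u).1 D <-> D = D4 \/ D = D3].
Proof.
have n1 : (-1 : R) != 0 by rewrite oppr_eq0 oner_eq0.
have [x [u [x0 ux mu su]]] := axis_half n1.
by exists u; split=> // D; rewrite ux; apply: axis_adjacent_left; lra.
Qed.

(** Between [s] and [u] there is a parameter [v] so close to [s] that it lies on the horizontal
    axis; adjacency is constant from [v] to [u]. *)
Lemma axis_edge u : ~ multiple K u -> clear K s u ->
  (forall D, adjacent_domain K (K u).1 D <-> D = D1 \/ D = D2) \/
  (forall D, adjacent_domain K (K u).1 D <-> D = D4 \/ D = D3).
Proof.
move=> mu su; have /nbhs_ballP[e /= e0 eP] := axis_strand chart.
have us : u <> s by move=> us; rewrite us in mu; exact/mu/axis_multiple.
have [v [vs vu]] : exists v, `|s - v| < e /\ (s < v < u \/ u < v < s).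
  have [us'|su'|//] := ltgtP u s.
    have [h|h] := ltP e (s - u).
      by exists (s - e / 2); rewrite ltr_norml; split; [lra|right; lra].
    by exists ((s + u) / 2); rewrite ltr_norml; split; [lra|right; lra].
  have [h|h] := ltP e (u - s).
    by exists (s + e / 2); rewrite ltr_norml; split; [lra|left; lra].
  by exists ((s + u) / 2); rewrite ltr_norml; split; [lra|left; lra].
have mv : ~ multiple K v by exact: su.
have cvu : clear K v u.
  by move=> w wP; apply: su; case: vu wP => ? [?|?]; [left|left|right|right]; lra.
rewrite -(adjacent_clear K_regular mv mu cvu).
have [x vx] := eP v vs; rewrite vx.
have x0 : x <> 0.
  by move=> x0; apply: mv; rewrite /multiple vx x0 (axis_center chart); exact: axis_multiple.
have [x0'|x0'|//] := ltgtP x 0.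
  by right=> D; exact: axis_adjacent_left.
by left=> D; exact: axis_adjacent_right.
Qed.

(** * Colours of the domains on the two sides of a strand *)

Variable g : pt -> bool.
Hypothesis g_good : forall z, good_at (projection K) (multiple_point K) g z.

Lemma domain_colour D z z' : domain K D -> D z -> D z' -> g z = g z'.
Proof.
move=> dD; apply: (colouring_connected (domain_connected dD)) => v Dv.
by split; [exact: domain_projection dD Dv|exact: g_good].
Qed.

Lemma sides_colour V S T DS DT p z z' : two_sided (projection K) V S T -> V p ->
  projection K p -> ~ multiple_point K p -> domain K DS -> domain K DT ->
  S `<=` DS -> T `<=` DT -> DS z -> DT z' -> g z != g z'.
Proof.
move=> ts Vp Pp Mp dS dT SD TD Dz Dz'.
have [c [gS gT]] := two_sided_colours ts Vp Pp Mp (fun q _ => g_good q).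
have [y [Sy _]] := side_closure1 ts (conj Vp Pp) filterT.
have [y' [Ty' _]] := side_closure2 ts (conj Vp Pp) filterT.
rewrite (domain_colour dS Dz (SD _ Sy)) (domain_colour dT Dz' (TD _ Ty')).
by rewrite gS // gT //; case: (c).
Qed.

Lemma axis_colour_right z z' : D1 z -> D2 z' -> g z != g z'.
Proof.
have [x [u [x0 ux mu _]]] := axis_half (oner_neq0 R).
rewrite mul1r in ux; have [V [S [T [ts Vx SD TD]]]] := axis_sides_right x0.
apply: (sides_colour ts Vx) => //; last by rewrite -ux.
by apply/axis_projection; right.
Qed.

Lemma axis_colour_left z z' : D4 z -> D3 z' -> g z != g z'.
Proof.
have n1 : (-1 : R) != 0 by rewrite oppr_eq0 oner_eq0.
have [x [u [x0 ux mu _]]] := axis_half n1.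
have x0' : -1 * x < 0 by lra.
have [V [S [T [ts Vx SD TD]]]] := axis_sides_left x0'.
apply: (sides_colour ts Vx) => //; last by rewrite -ux.
by apply/axis_projection; right.
Qed.

End Chart.

End AxisCharts.

(** * The Dehn data of a common alternating projection *)

Section DehnData.
Variables (R : realType) (K : knot R).
Local Notation pt := (R * R)%type.
Hypothesis K_regular : regular_projection K.

Lemma other_end s u : multiple K s -> ~ multiple K u -> clear K s u ->
  exists t, [/\ multiple K t, clear K t u & t <> s].
Proof.
move=> ms mu su; have [us|su'|e] := ltgtP u s; last by rewrite e in mu.
  have [t [mt tu tP]] := prev_multiple K_regular ms mu.
  exists t; split=> //; last by move=> e; rewrite e in tu; lra.
  by move=> w [|wut]; [exact: tP|lra].
have [t [mt ut tP]] := next_multiple K_regular ms mu.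
exists t; split=> //; last by move=> e; rewrite e in ut; lra.
by move=> w [wtu|]; [lra|exact: tP].
Qed.

Lemma boundary_adjacent D u z : ~ multiple K u -> adjacent_domain K (K u).1 D ->
  connected_component (projection K `\` multiple_point K) (K u).1 z -> boundary D z.
Proof.
move=> mu au Cz; have Cu : connected_component (projection K `\` multiple_point K) (K u).1 (K u).1.
  by apply: connected_component_refl; split=> //; apply/projectionP; exists u.
have [] : adjacent_domain K z D.
  by rewrite (adjacent_connected K_regular
    (@component_connected _ (projection K `\` multiple_point K) (K u).1)
    (@connected_component_sub _ _ _) Cz Cu).
move=> dD clD; split=> // /nbhs_singleton/(domain_projection dD); apply.
by have [] := connected_component_sub Cz.
Qed.

(** The edges through both points lie in the boundaries of [D1] and of [D2], so commonness
    identifies them. *)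
Lemma common_edge D1 D2 u v : common_projection K -> D1 <> D2 ->
  ~ multiple K u -> ~ multiple K v ->
  adjacent_domain K (K u).1 D1 -> adjacent_domain K (K u).1 D2 ->
  adjacent_domain K (K v).1 D1 -> adjacent_domain K (K v).1 D2 ->
  connected_component (projection K `\` multiple_point K) (K u).1 (K v).1.
Proof.
move=> [common _] D12 mu mv u1 u2 v1 v2.
have on_edge w : ~ multiple K w -> (projection K `\` multiple_point K) (K w).1.
  by move=> mw; split=> //; apply/projectionP; exists w.
rewrite (common D1 D2 u1.1 u2.1 D12
  (connected_component (projection K `\` multiple_point K) (K u).1)
  (connected_component (projection K `\` multiple_point K) (K v).1)).
- exact/connected_component_refl/on_edge.
- by exists (K u).1 => //; exact: on_edge.
- by exists (K v).1 => //; exact: on_edge.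
- by move=> z Cz; split; exact: boundary_adjacent Cz.
- by move=> z Cz; split; exact: boundary_adjacent Cz.
Qed.

Lemma crossing_heights p s t psi : crossing_chart K p s t psi ->
  [/\ over_at K s, ~ under_at K s, under_at K t & ~ over_at K t].
Proof.
case=> _ _ _ Ks Kt h dbl _ _; split.
- by exists (K t); [exists t|rewrite Ks Kt].
- move=> [_ [u _ <-] [us hs]]; rewrite Ks in us; have [e|e] := dbl u us.
    by rewrite e ltxx in hs.
  by rewrite e in hs; have := lt_trans h hs; rewrite ltxx.
- by exists (K s); [exists s|rewrite Ks Kt].
- move=> [_ [u _ <-] [us hs]]; rewrite Kt in us; have [e|e] := dbl u us.
    by rewrite e in hs; have := lt_trans h hs; rewrite ltxx.
  by rewrite e ltxx in hs.
Qed.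

Hypothesis K_alternating : alternating_projection K.
Hypothesis K_common : common_projection K.
Variables (n m : nat) (x : 'I_n.+1 -> set pt) (a b c d : 'I_m -> 'I_n.+1).
Hypothesis x_domain : forall i, domain K (x i).
Hypothesis x_surj : forall D, domain K D -> exists i, x i = D.
Hypothesis x_inj : injective x.
Variables (p : 'I_m -> pt) (S T : 'I_m -> R) (psi : 'I_m -> pt -> pt).
Hypothesis p_inj : injective p.
Hypothesis p_surj : forall z, multiple_point K z -> exists j, p j = z.
Hypothesis chart : forall j, crossing_chart K (p j) (S j) (T j) (psi j).
Hypothesis quadrant_a : forall j, psi j @` [set q | 0 < q.1 /\ 0 < q.2] `<=` x (a j).
Hypothesis quadrant_b : forall j, psi j @` [set q | 0 < q.1 /\ q.2 < 0] `<=` x (b j).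
Hypothesis quadrant_c : forall j, psi j @` [set q | q.1 < 0 /\ q.2 < 0] `<=` x (c j).
Hypothesis quadrant_d : forall j, psi j @` [set q | q.1 < 0 /\ 0 < q.2] `<=` x (d j).

Lemma over_chart j : axis_chart K (S j) (T j) (psi j).
Proof. exact: crossing_chart_over (chart j). Qed.

Lemma under_chart j : axis_chart K (T j) (S j) (psi j \o flip (R := R)).
Proof. exact: crossing_chart_under (chart j). Qed.

(** Exchanging the axes preserves the quadrants of [a] and [c] and swaps those of [b] and [d]. *)
Lemma flip_quadrant (f : pt -> pt) (A B : set pt) D :
  (forall q, A q -> B (flip q)) -> f @` B `<=` D -> (f \o flip (R := R)) @` A `<=` D.
Proof. by move=> AB fD _ [q Aq <-]; apply: fD; exists (flip q) => //; exact: AB. Qed.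

Lemma under_quadrant_a j : (psi j \o flip (R := R)) @` [set q | 0 < q.1 /\ 0 < q.2] `<=` x (a j).
Proof. by apply: flip_quadrant (@quadrant_a j) => q []. Qed.

Lemma under_quadrant_d j : (psi j \o flip (R := R)) @` [set q | 0 < q.1 /\ q.2 < 0] `<=` x (d j).
Proof. by apply: flip_quadrant (@quadrant_d j) => q []. Qed.

Lemma under_quadrant_c j : (psi j \o flip (R := R)) @` [set q | q.1 < 0 /\ q.2 < 0] `<=` x (c j).
Proof. by apply: flip_quadrant (@quadrant_c j) => q []. Qed.

Lemma under_quadrant_b j : (psi j \o flip (R := R)) @` [set q | q.1 < 0 /\ 0 < q.2] `<=` x (b j).
Proof. by apply: flip_quadrant (@quadrant_b j) => q []. Qed.

(** Every domain with the crossing on its boundary contains a point of a quadrant, so its label is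
    in the list; commonness gives four such domains, and a list of length four containing four
    distinct labels has no repetition. *)
Lemma domains_distinct j : uniq [:: a j; b j; c j; d j].
Proof.
pose A := [set i | boundary (x i) (p j)].
have psi0 : p j \in [set psi j q | q in setT].
  by rewrite inE; exists (0, 0) => //; exact: chart_center (chart j).
have sub i : boundary (x i) (p j) -> i \in [:: a j; b j; c j; d j].
  case=> cl _; have [_ _ opsi] := chart_embedding (chart j).
  have [y [xw [q _ qw]]] := cl _ (open_nbhs_nbhs (conj (opsi _ openT) (set_mem psi0))).
  rewrite -qw in xw; have nP := domain_projection (x_domain i) xw.
  have meet i' : x i' (psi j q) -> i = i'.
    by move=> x'; apply/x_inj/(domain_eq (x_domain i) (x_domain i') xw x').
  have /not_orP[/eqP + /eqP] : ~ (q.1 = 0 \/ q.2 = 0).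
    by move=> q0; apply: nP; apply/(axis_projection (over_chart j)).
  rewrite !neq_lt !inE => /orP[q1|q1] /orP[q2|q2].
  - by rewrite (meet (c j)) ?eqxx ?orbT //; apply: quadrant_c; exists q.
  - by rewrite (meet (d j)) ?eqxx ?orbT //; apply: quadrant_d; exists q.
  - by rewrite (meet (b j)) ?eqxx ?orbT //; apply: quadrant_b; exists q.
  - by rewrite (meet (a j)) ?eqxx ?orbT //; apply: quadrant_a; exists q.
have Mp : multiple_point K (p j).
  by rewrite -(chart_over_center (chart j)); exact: axis_multiple (over_chart j).
have [_ /(_ _ Mp)/card_set_bijP[f [_ _ fsurj]]] := K_common.
have /choice[h hP] (k : 'I_4) : exists i, i \in [:: a j; b j; c j; d j] /\ f (x i) = k.
  have [D [dD bD] fD] := fsurj k (ltn_ord k).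
  have [i xi] := x_surj dD; exists i; rewrite xi; split=> //.
  by apply: sub; rewrite xi.
have h_inj : injective h.
  by move=> k k' e; apply: val_inj; rewrite /= -(hP k).2 -(hP k').2 e.
apply: (@leq_size_uniq _ (map h (enum 'I_4))).
- by rewrite map_inj_uniq ?enum_uniq.
- by move=> _ /mapP[k _ ->]; exact: (hP k).1.
- by rewrite size_map size_enum_ord.
Qed.

Lemma exists_checkerboard : exists col : 'I_n.+1 -> bool, forall j,
  [/\ col (a j) != col (b j), col (b j) != col (c j) & col (a j) != col (d j)].
Proof.
have [g gP] := exists_colouring (@projection_closed R K) (multiple_finite K_regular)
  (regular_arc K_regular) (regular_crossing K_regular).
have /choice[w wP] i : exists z, x i z by exact: domain_nonempty (x_domain i).
exists (fun i => g (w i)) => j; split.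
- exact: (axis_colour_right K_regular (over_chart j) (x_domain _) (x_domain _)
    (@quadrant_a j) (@quadrant_b j) gP).
- exact: (axis_colour_left K_regular (under_chart j) (x_domain _) (x_domain _)
    (@under_quadrant_c j) (@under_quadrant_b j) gP).
- exact: (axis_colour_right K_regular (under_chart j) (x_domain _) (x_domain _)
    (@under_quadrant_a j) (@under_quadrant_d j) gP).
Qed.

(** * Pairs of domains, edges and their ends *)

Definition edge_between u i i' : Prop :=
  ~ multiple K u /\ forall D, adjacent_domain K (K u).1 D <-> D = x i \/ D = x i'.

Lemma edge_betweenC u i i' : edge_between u i i' -> edge_between u i' i.
Proof. by move=> [mu uP]; split=> // D; rewrite uP; tauto. Qed.

Lemma edge_between_inj u i i' k k' : i <> i' -> edge_between u i i' -> edge_between u k k' ->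
  i = k /\ i' = k' \/ i = k' /\ i' = k.
Proof.
move=> ii' [_ uP] [_ uP'].
have : x i = x k \/ x i = x k' by apply/uP'/uP; left.
have : x i' = x k \/ x i' = x k' by apply/uP'/uP; right.
by move=> [/x_inj e|/x_inj e] [/x_inj e'|/x_inj e']; [|right|left|]; subst.
Qed.

Lemma over_pair_edge j i i' : over_pair a b c d j i i' ->
  exists u, clear K (S j) u /\ edge_between u i i'.
Proof.
have [u [mu su uP]] := axis_edge_right K_regular (over_chart j) (x_domain _) (x_domain _)
  (@quadrant_a j) (@quadrant_b j).
have [v [mv sv vP]] := axis_edge_left K_regular (over_chart j) (x_domain _) (x_domain _)
  (@quadrant_c j) (@quadrant_d j).
rewrite /over_pair !inE => /or4P[] /eqP[-> ->].
- by exists u.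
- by exists u; split=> //; exact: edge_betweenC.
- by exists v; split=> //; exact: edge_betweenC.
- by exists v.
Qed.

Lemma under_pair_edge j i i' : under_pair a b c d j i i' ->
  exists u, clear K (T j) u /\ edge_between u i i'.
Proof.
have [u [mu su uP]] := axis_edge_right K_regular (under_chart j) (x_domain _) (x_domain _)
  (@under_quadrant_a j) (@under_quadrant_d j).
have [v [mv sv vP]] := axis_edge_left K_regular (under_chart j) (x_domain _) (x_domain _)
  (@under_quadrant_c j) (@under_quadrant_b j).
rewrite /under_pair !inE => /or4P[] /eqP[-> ->].
- by exists u.
- by exists u; split=> //; exact: edge_betweenC.
- by exists v.
- by exists v; split=> //; exact: edge_betweenC.
Qed.

Lemma over_pair_neq j i i' : over_pair a b c d j i i' -> i <> i'.
Proof.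
have [? ? ? ? [? ?]] := distinctP domains_distinct j.
by rewrite /over_pair !inE => /or4P[] /eqP[-> ->] //; exact: nesym.
Qed.

Lemma under_pair_neq j i i' : under_pair a b c d j i i' -> i <> i'.
Proof.
have [? ? ? ? [? ?]] := distinctP domains_distinct j.
by rewrite /under_pair !inE => /or4P[] /eqP[-> ->] //; exact: nesym.
Qed.

Lemma over_at_shift s k : over_at K (s + k%:~R) = over_at K s.
Proof. by rewrite /over_at knot_shift. Qed.

Lemma under_at_shift s k : under_at K (s + k%:~R) = under_at K s.
Proof. by rewrite /under_at knot_shift. Qed.

(* By alternation the two ends of an edge have different heights. *)
Lemma edge_end s s' u v i i' : i <> i' -> multiple K s -> multiple K s' ->
  clear K s u -> clear K s' v -> edge_between u i i' -> edge_between v i i' ->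
  ~ (over_at K s <-> under_at K s') -> ~ (over_at K s' <-> under_at K s) ->
  exists k, s = s' + k%:~R.
Proof.
move=> ii' ms ms' su sv [mu uP] [mv vP] hn hn'.
have xii' : x i <> x i' by move=> /x_inj.
have [k uv] : exists k, clear K u (v + k%:~R).
  apply: (same_edge K_regular ms mu mv); apply: (common_edge K_common xii' mu mv).
  - by apply/uP; left.
  - by apply/uP; right.
  - by apply/vP; left.
  - by apply/vP; right.
have ms'k : multiple K (s' + k%:~R) by exact/multiple_shift.
have mvk : ~ multiple K (v + k%:~R) by move/multiple_shift.
exists k; apply: (clear_ends K_alternating ms ms'k mu mvk su uv (clear_sym (clear_shift (k := k) sv))).
- by rewrite under_at_shift.
- by rewrite over_at_shift.
Qed.

(** Both crossings are ends of the one edge between the two domains, and an edge has a single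
    overcrossing end up to the period. *)
Lemma over_pair_inj j j' i i' : over_pair a b c d j i i' -> over_pair a b c d j' i i' -> j = j'.
Proof.
move=> ov ov'; have [u [su ue]] := over_pair_edge ov; have [v [sv ve]] := over_pair_edge ov'.
have [hov nun _ _] := crossing_heights (chart j); have [hov' nun' _ _] := crossing_heights (chart j').
have [k e] : exists k, S j = S j' + k%:~R.
  have msj := axis_multiple (over_chart j); have msj' := axis_multiple (over_chart j').
  by apply: (edge_end (over_pair_neq ov) msj msj' su sv ue ve); tauto.
apply: p_inj; rewrite -(chart_over_center (chart j)) -(chart_over_center (chart j')).
by rewrite e knot_shift.
Qed.

Lemma under_pair_inj j j' i i' :
  under_pair a b c d j i i' -> under_pair a b c d j' i i' -> j = j'.
Proof.
move=> un un'; have [u [su ue]] := under_pair_edge un; have [v [sv ve]] := under_pair_edge un'.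
have [_ _ hun nov] := crossing_heights (chart j); have [_ _ hun' nov'] := crossing_heights (chart j').
have [k e] : exists k, T j = T j' + k%:~R.
  have msj := axis_multiple (under_chart j); have msj' := axis_multiple (under_chart j').
  by apply: (edge_end (under_pair_neq un) msj msj' su sv ue ve); tauto.
apply: p_inj; rewrite -(chart_under_center (chart j)) -(chart_under_center (chart j')).
by rewrite e knot_shift.
Qed.

Lemma clear_refl u : clear K u u.
Proof. by move=> w [] /andP[uw wu]; have := lt_trans uw wu; rewrite ltxx. Qed.

Lemma multiple_crossing t : multiple K t -> exists j k,
  t = S j + k%:~R \/ t = T j + k%:~R.
Proof.
move=> /p_surj[j pj]; exists j; rewrite -(chart_over_center (chart j)) in pj.
have [/knot_period[k ->]|/knot_period[k ->]] := axis_double (over_chart j) (esym pj);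
  exists k; [by left|by right].
Qed.

Lemma edge_between_shift u k i i' : edge_between u i i' -> edge_between (u + k%:~R) i i'.
Proof. by case=> mu uP; split=> [/multiple_shift//|D]; rewrite knot_shift. Qed.

(** The edge that leaves [S j] between the two domains has another end, an undercrossing by
    alternation; the domains along the edge are then read in the chart at that end. *)
Lemma over_pair_under j i i' : over_pair a b c d j i i' -> exists j', under_pair a b c d j' i i'.
Proof.
move=> ov; have [u [su ue]] := over_pair_edge ov; have [hov nun _ _] := crossing_heights (chart j).
have ms := axis_multiple (over_chart j); have mu := ue.1.
have [t [mt tu ts]] := other_end ms mu su.
have [j' [k [tE|tE]]] := multiple_crossing mt.
  have [hov' nun' _ _] := crossing_heights (chart j').
  case: ts; apply/esym; apply: (clear_ends K_alternating ms mt mu mu su (@clear_refl u) (clear_sym tu)).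
    by rewrite tE under_at_shift; tauto.
  by rewrite tE over_at_shift; tauto.
(* Translating by the period brings the edge next to the chosen parameter [T j']. *)
exists j'; have := clear_shift (k := - k) tu; rewrite tE rmorphN /= addrK => Tu.
have ue' := edge_between_shift (- k) ue; rewrite rmorphN /= in ue'.
have neq := over_pair_neq ov; rewrite /under_pair !inE.
have [uP|uP] := axis_edge K_regular (under_chart j') (x_domain _) (x_domain _) (x_domain _)
    (x_domain _) (@under_quadrant_a j') (@under_quadrant_d j') (@under_quadrant_c j')
    (@under_quadrant_b j') ue'.1 Tu;
  by have [[-> ->]|[-> ->]] := edge_between_inj neq ue' (conj ue'.1 uP); rewrite eqxx ?orbT.
Qed.

Lemma under_pair_over j i i' : under_pair a b c d j i i' -> exists j', over_pair a b c d j' i i'.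
Proof.
move=> un; have [u [su ue]] := under_pair_edge un; have [_ _ hun nov] := crossing_heights (chart j).
have ms := axis_multiple (under_chart j); have mu := ue.1.
have [t [mt tu ts]] := other_end ms mu su.
have [j' [k [tE|tE]]] := multiple_crossing mt; last first.
  have [_ _ hun' nov'] := crossing_heights (chart j').
  case: ts; apply/esym; apply: (clear_ends K_alternating ms mt mu mu su (@clear_refl u) (clear_sym tu)).
    by rewrite tE under_at_shift; tauto.
  by rewrite tE over_at_shift; tauto.
exists j'; have := clear_shift (k := - k) tu; rewrite tE rmorphN /= addrK => Tu.
have ue' := edge_between_shift (- k) ue; rewrite rmorphN /= in ue'.
have neq := under_pair_neq un; rewrite /over_pair !inE.
have [uP|uP] := axis_edge K_regular (over_chart j') (x_domain _) (x_domain _) (x_domain _)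
    (x_domain _) (@quadrant_a j') (@quadrant_b j') (@quadrant_c j')
    (@quadrant_d j') ue'.1 Tu;
  by have [[-> ->]|[-> ->]] := edge_between_inj neq ue' (conj ue'.1 uP); rewrite eqxx ?orbT.
Qed.

Lemma diagram_complete_rewriting : exists RR : set (seq (letter 'I_n) * seq (letter 'I_n)),
  [/\ rewriting_system_for_dehn a b c d RR, complete_rewriting RR & finite_set RR].
Proof.
have [col colP] := exists_checkerboard.
apply: (checkerboard_complete_rewriting (col := col) domains_distinct).
- by move=> j; case: (colP j).
- by move=> j; case: (colP j).
- by move=> j; case: (colP j).
- exact: over_pair_inj.
- exact: under_pair_inj.
- move=> i i'; split=> -[j]; [exact: over_pair_under|exact: under_pair_over].
Qed.

End DehnData.

Theorem mainTheorem1 (R : realType) (K : knot R)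
    (K_tame : tame K) (K_prime : prime_knot K)
    (K_regular : regular_projection K)
    (K_alternating : alternating_projection K)
    (K_common : common_projection K)
    (n m : nat) (x : 'I_n.+1 -> set (plane R)) (a b c d : 'I_m -> 'I_n.+1)
    (K_dehn : dehn_data K x a b c d) :
  exists RR : set (seq (letter 'I_n) * seq (letter 'I_n)),
    [/\ rewriting_system_for_dehn a b c d RR,
        complete_rewriting RR &
        finite_set RR].
Proof.
have [[[x_dom x_inj x_surj] _] [p [p_mult p_inj p_surj] around]] := K_dehn.
(* Both parameters and the chart are packed in one triple, so that a single choice fixes them at all
   crossings. *)
have /choice[F FP] j : exists f : R * R * (R * R -> R * R),
    [/\ crossing_chart K (p j) f.1.1 f.1.2 f.2,
      f.2 @` [set q | 0 < q.1 /\ 0 < q.2] `<=` x (a j),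
      f.2 @` [set q | 0 < q.1 /\ q.2 < 0] `<=` x (b j),
      f.2 @` [set q | q.1 < 0 /\ q.2 < 0] `<=` x (c j) &
      f.2 @` [set q | q.1 < 0 /\ 0 < q.2] `<=` x (d j)].
  by have [s [t [psi psiP]]] := around j; exists (s, t, psi).
apply: (@diagram_complete_rewriting _ _ K_regular K_alternating K_common _ _ x a b c d
  _ _ _ p (fun j => (F j).1.1) (fun j => (F j).1.2) (fun j => (F j).2)).
- by move=> i; exact: x_dom.
- by move=> D /x_surj[i _ <-]; exists i.
- by move=> i i' e; apply: x_inj; rewrite ?inE.
- by move=> i i' e; apply: p_inj; rewrite ?inE.
- by move=> z /p_surj[j _ <-]; exists j.
- by move=> j; case: (FP j).
- by move=> j; case: (FP j).
- by move=> j; case: (FP j).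
- by move=> j; case: (FP j).
- by move=> j; case: (FP j).
Qed.
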